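(* Let $\nu\ge1$ be an integer, $u>0$, $\mathscr V(z;u)=\frac{z^2}{2}+u\frac{z^{2\nu}}{2\nu}$, and define the eigenvalue partition function $\mathcal Z_{nN}(u)=\int_{\mathbb R^n}\prod_{1\le j<k\le n}(z_j-z_k)^2\prod_{j=1}^n e^{-N\mathscr V(z_j;u)}\,dz_1\cdots dz_n$ and the free energy $\mathcal F_{nN}(u)=\frac1{n^2}\ln\frac{\mathcal Z_{nN}(u)}{\mathcal Z_{nN}(0)}$. Let $x=n/N$ and let $\mathcal F_{nN}\sim\sum_{g=0}^\infty f_{2g}(x;u)N^{-2g}$ ($N\to\infty$) be its topological expansion, with $f_{2g}$ analytic near $(x,u)=(1,0)$. Write $f_{2g}(x;u)=\sum_{j=0}^\infty\alpha_{2g,j}(x)u^j$. Then $\alpha_{2g,j}(x)=\tilde c_{2g,j}\,x^{\widetilde{\mathscr D}}$ for a constant $\tilde c_{2g,j}$, where $\widetilde{\mathscr D}=j(\nu-1)-2g$. Moreover, if $\widetilde{\mathscr D}<-2$ then $\alpha_{2g,j}(x)=\tilde c_{2g,j}=0$.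
   Context: The existence of the topological expansion of $\mathcal F_{nN}$ in powers of $N^{-2}$, valid for $x$ near $1$ and small $u$, with coefficients $f_{2g}(x;u)$ analytic near $(1,0)$, is taken as known. *)

(* Defs.v *)
From HB Require Import structures.
From mathcomp Require Import all_boot all_order all_algebra.
From mathcomp Require Import all_classical all_reals all_analysis.

Set Implicit Arguments.
Unset Strict Implicit.
Unset Printing Implicit Defensive.

Import Order.TTheory GRing.Theory Num.Theory.
Import numFieldNormedType.Exports.

Local Open Scope classical_set_scope.
Local Open Scope ring_scope.

(* The image of m1 \x m under (z, t) |-> z :: t. *)
Section cons_measure.
Context (d : measure_display) (T : measurableType d) (R : realType) (n : nat).
Variable m1 : {sigma_finite_measure set T -> \bar R}.
Variable m : {sigma_finite_measure set (n.-tuple T) -> \bar R}.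

Definition consp (p : T * n.-tuple T) : n.+1.-tuple T :=
  [the n.+1.-tuple T of p.1 :: p.2].

Lemma measurable_consp : measurable_fun setT consp.
Proof. exact: measurable_cons. Qed.

Definition cons_measure : set (n.+1.-tuple T) -> \bar R :=
  pushforward (m1 \x m)%E consp.

Let cons_measure0 : cons_measure set0 = 0%E.
Proof. by rewrite /cons_measure /pushforward preimage_set0 measure0. Qed.

Let cons_measure_ge0 A : (0 <= cons_measure A)%E.
Proof. by rewrite /cons_measure /pushforward; exact: measure_ge0. Qed.

Let cons_measure_sigma_additive : semi_sigma_additive cons_measure.
Proof.
move=> F mF tF mUF; rewrite /cons_measure /pushforward preimage_bigcup.
apply: measure_semi_sigma_additive.
- by move=> i; rewrite -[X in measurable X]setTI; exact: measurable_consp.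
- apply/trivIsetP => /= i j _ _ ij; rewrite -preimage_setI.
  by move/trivIsetP : tF => /(_ _ _ _ _ ij) ->//; rewrite preimage_set0.
- rewrite -preimage_bigcup -[X in measurable X]setTI.
  exact: measurable_consp.
Qed.

HB.instance Definition _ := isMeasure.Build _ _ _ cons_measure
  cons_measure0 cons_measure_ge0 cons_measure_sigma_additive.

Let cons_measure_sigma_finite : sigma_finite setT cons_measure.
Proof.
have /sigma_finiteP[F [TF ndF Foo]] := sigma_finiteT m1.
have /sigma_finiteP[G [TG ndG Goo]] := sigma_finiteT m.
pose h (t : n.+1.-tuple T) : T * n.-tuple T := (thead t, [tuple of behead t]).
have mh : measurable_fun setT h.
  apply: measurable_fun_pair; first exact: measurable_tnth.
  exact: measurable_behead.
have hK : cancel consp h.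
  by case=> x t; rewrite /h /consp /= theadE; congr pair; exact: val_inj.
exists (fun i => h @^-1` (F i `*` G i)).
  rewrite -preimage_bigcup (_ : \bigcup_i _ = setT) ?preimage_setT//.
  rewrite -setXTT TF TG predeqE => -[x y]; split.
    by move=> [i _ []/= ? ?]; split; exists i.
  move=> [/= [i _ Fix] [k _ Gky]]; exists (maxn i k) => //; split.
  - by move: x Fix; exact/subsetPset/ndF/leq_maxl.
  - by move: y Gky; exact/subsetPset/ndG/leq_maxr.
move=> i; have [mF Fi] := Foo i; have [mG Gi] := Goo i; split.
  by rewrite -[X in measurable X]setTI; apply: mh => //; exact: measurableX.
rewrite /cons_measure /pushforward -comp_preimage.
rewrite (_ : h \o consp = id) ?preimage_id; last first.
  by apply/funext => p; exact: hK.
by rewrite product_measure1E// lte_mul_pinfty// ge0_fin_numE.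
Qed.

HB.instance Definition _ := Measure_isSigmaFinite.Build _ _ _ cons_measure
  cons_measure_sigma_finite.

End cons_measure.

(* Lebesgue measure on R^n, with R^n represented by [n.-tuple R]. *)
Fixpoint lebesgue_tuple (R : realType) (n : nat) :
    {sigma_finite_measure set (n.-tuple (measurableTypeR R)) -> \bar R} :=
  match n with
  | 0 => \d_([tuple] : 0.-tuple (measurableTypeR R))
  | n'.+1 => cons_measure (@lebesgue_measure R) (lebesgue_tuple R n')
  end.

Section matrix_model.
Context (R : realType) (nu : nat).

Definition potential (z u : R) : R :=
  z ^+ 2 / 2 + u * (z ^+ (2 * nu) / (2 * nu)%:R).

Definition partition_function (n N : nat) (u : R) : R :=
  \int[lebesgue_tuple R n]_z
    ((\prod_(j < n) \prod_(k < n | (j < k)%N) (tnth z j - tnth z k) ^+ 2) *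
     \prod_(j < n) expR (- (N%:R * potential (tnth z j) u))).

Definition free_energy (n N : nat) (u : R) : R :=
  (n%:R ^+ 2)^-1 * ln (partition_function n N u / partition_function n N 0).

(* [f g] stands for the coefficient f_{2g} of N^(-2g).  The remainder estimate
   is uniform for n/N near 1 and small u > 0; the neighbourhood and the
   constant may depend on the order K of truncation. *)
Definition topological_expansion (f : nat -> R -> R -> R) : Prop :=
  forall K : nat, exists (eps del C : R) (N0 : nat),
    [/\ 0 < eps, 0 < del &
     forall (n N : nat) (u : R), (0 < n)%N -> (0 < N)%N -> (N0 <= N)%N ->
       `|n%:R / N%:R - 1| < eps -> 0 < u < del ->
       `|free_energy n N u -
           \sum_(g < K.+1) f g (n%:R / N%:R) u / N%:R ^+ (2 * g)|
         <= C / N%:R ^+ (2 * K.+1)].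

Definition scaling_exponent (g j : nat) : int :=
  j%:Z * (nu%:Z - 1) - 2 * g%:Z.

End matrix_model.

(* f is the sum of an absolutely convergent double power series centred at
   (x0, u0) on the box |x - x0| < rho, |u - u0| < delta. *)
Definition analytic_on_box (R : realType) (f : R -> R -> R)
    (x0 u0 rho delta : R) : Prop :=
  exists a : nat -> nat -> R, forall x u : R,
    `|x - x0| < rho -> `|u - u0| < delta ->
    let t k l := a k l * (x - x0) ^+ k * (u - u0) ^+ l in
    summable [set: nat * nat] (fun p => (t p.1 p.2)%:E) /\
    (\sum_(k < m) \sum_(l < m) t k l) @[m --> \oo] --> f x u.

(* Main.v *)
Require Import Defs.
From HB Require Import structures.
From mathcomp Require Import all_boot all_order all_algebra.
From mathcomp Require Import ring lra zify.
From mathcomp Require mpoly.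

(** Write [Q = \sum_i z_i ^ (2 nu) / (2 nu)].  Integrating by parts against the
    Gaussian weight [exp (- N z^2 / 2)] gives loop equations that express the
    moments of power sums under the Gaussian ensemble through moments of lower
    total degree; hence the expectation of [(N u Q)^j] equals [t^j m_j(n)] with
    [t = u / N^(nu-1)] and [m_j] a polynomial.  Taylor's formula for [exp] and
    [ln] turns this into an expansion of [n^2 F_{nN}(u)] in powers of [t] with
    coefficients [P_j(n)] polynomial in [n] and a remainder that is polynomially
    bounded in [n].  Comparing it with the topological expansion along
    [n = (k + 1) m], [N = k m], [m -> oo], with [u] a small power of [1 / m],
    identifies [alpha_{2g,j}(x)] for [x = 1 + 1 / k] as the coefficient of
    [n^(D + 2)] in [P_j] times [x^D], where [D = j (nu - 1) - 2 g].  This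
    coefficient vanishes when [D + 2 < 0].  Since [alpha_{2g,j}] is given by a
    power series at [1], the identity extends from the points [1 + 1 / k] to the
    whole interval. *)

Set Implicit Arguments.
Unset Strict Implicit.
Unset Printing Implicit Defensive.

Import Order.TTheory GRing.Theory Num.Theory.
Local Open Scope ring_scope.

(** * Loop equations *)

(** The exponent is forced because [N] enters only through [t]: a monomial [n^d] of [P_j]
    contributes [n^(d-2) N^(-j(nu-1)) u^j] to the free energy, which for [n = x N] is
    [x^(d-2) N^(d-2-j(nu-1)) u^j], and this has order [N^(-2g)] exactly when [d - 2 = D]. The
    obstacle is that coefficients of [u^j] cannot be compared by differentiating at [u = 0]: both
    expansions come with remainder bounds only, the bound for the Taylor expansion grows like a
    power of [n], and the one for the topological expansion does not shrink with [u]. Hence [u]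
    tends to [0] polynomially in [1 / m]: fast enough to beat the power of [n], yet slowly enough
    that a high truncation order makes the topological remainder negligible. For fixed [k] the ratio
    [x] is constant and the comparison becomes one of polynomials in the integer [m]. *)

Module LoopEquations.
Import mpoly.

Section loop_equation.
Context (R : comNzRingType) (n : nat).
Implicit Types p q : {mpoly R[n]}.

Definition power_sum k : {mpoly R[n]} := \sum_(i < n) 'X_i ^+ k.

Definition vandermonde2 : {mpoly R[n]} :=
  \prod_(j < n) \prod_(k < n | (j < k)%N) ('X_j - 'X_k) ^+ 2.

(** The operator $\sum_i z_i^k\,\partial_i$, a generator of the Witt algebra; integrating it by
    parts produces the loop equations. *)
Definition vector_field k p := \sum_(i < n) 'X_i ^+ k * p^`M(i).

Lemma vector_fieldM k p q :
  vector_field k (p * q) = vector_field k p * q + p * vector_field k q.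
Proof.
rewrite /vector_field mulr_suml mulr_sumr -big_split/=.
by apply: eq_bigr => i _; rewrite mderivM; ring.
Qed.

Lemma vector_fieldB k p q :
  vector_field k (p - q) = vector_field k p - vector_field k q.
Proof.
rewrite /vector_field -sumrB.
by apply: eq_bigr => i _; rewrite mderivB mulrBr.
Qed.

Lemma vector_field0 k : vector_field k 0 = 0.
Proof. by rewrite /vector_field big1// => i _; rewrite mderiv0 mulr0. Qed.

Lemma vector_fieldD k p q :
  vector_field k (p + q) = vector_field k p + vector_field k q.
Proof.
rewrite /vector_field -big_split.
by apply: eq_bigr => i _; rewrite mderivD mulrDr.
Qed.

Lemma vector_field_sum k I (r : seq I) (P : pred I) (F : I -> {mpoly R[n]}) :
  vector_field k (\sum_(i <- r | P i) F i) =
  \sum_(i <- r | P i) vector_field k (F i).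
Proof. exact: (big_morph _ (vector_fieldD k) (vector_field0 k)). Qed.

Lemma vector_field1 k : vector_field k 1 = 0.
Proof.
apply: (@addrI _ (vector_field k 1)).
by rewrite addr0 -[X in _ = vector_field k X]mul1r vector_fieldM mul1r mulr1.
Qed.

Lemma mderiv_var i j : ('X_i : {mpoly R[n]})^`M(j) = (i == j)%:R.
Proof.
rewrite mderivX mnm1E; case: eqVneq => [->|_]; last by rewrite scale0r.
rewrite scale1r (_ : (U_(j) - U_(j))%MM = 0%MM) ?mpolyX0//.
by apply/mnmP => l; rewrite mnmBE mnm0E subnn.
Qed.

Lemma vector_fieldX k i : vector_field k 'X_i = 'X_i ^+ k.
Proof.
rewrite /vector_field (bigD1 i)//= big1 => [|j ji].
  by rewrite addr0 mderiv_var eqxx mulr1.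
by rewrite mderiv_var eq_sym (negbTE ji) mulr0.
Qed.

Lemma vector_field_exp k p m :
  vector_field k (p ^+ m) = m%:R * p ^+ m.-1 * vector_field k p.
Proof.
elim: m => [|m ih]; first by rewrite expr0 vector_field1 !mul0r.
rewrite exprS vector_fieldM ih /=.
case: m {ih} => [|m]; first by rewrite expr0/= !mul0r mulr0 addr0 mulr1 !mul1r.
by rewrite /= exprS -[in RHS]natr1; ring.
Qed.

Lemma vector_field_power_sum k m :
  vector_field k (power_sum m) = m%:R * power_sum (m.-1 + k).
Proof.
rewrite /power_sum vector_field_sum mulr_sumr; apply: eq_bigr => i _.
by rewrite vector_field_exp vector_fieldX exprD; ring.
Qed.

(** [c i] is the logarithmic derivative of [F i], written as a cofactor so that no division leaves
    the polynomial ring. *)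
Lemma vector_field_prod_log k I (r : seq I) (P : pred I)
    (F c : I -> {mpoly R[n]}) :
  (forall i, P i -> vector_field k (F i) = F i * c i) ->
  vector_field k (\prod_(i <- r | P i) F i) =
  (\prod_(i <- r | P i) F i) * \sum_(i <- r | P i) c i.
Proof.
move=> h; elim/big_rec2: _ => [|i y1 y2 Pi e]; first by rewrite vector_field1 mulr0.
by rewrite vector_fieldM e h//; ring.
Qed.

(** The quotient of ['X_i ^+ k - 'X_j ^+ k] by ['X_i - 'X_j], written out so that it also makes
    sense for [i = j], where it is the derivative of ['X_i ^+ k]. *)
Definition divided_difference k (i j : 'I_n) : {mpoly R[n]} :=
  \sum_(l < k) 'X_i ^+ (k.-1 - l) * 'X_j ^+ l.

Lemma divided_differenceC k i j :
  divided_difference k i j = divided_difference k j i.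
Proof.
rewrite /divided_difference (reindex_inj rev_ord_inj)/=.
apply: eq_bigr => l _; rewrite mulrC.
have lk := ltn_ord l.
by congr (_ ^+ _ * _ ^+ _); lia.
Qed.

(** A squared factor has twice the divided difference as logarithmic derivative; by symmetry the two
    copies are shared between the ordered pairs [(i, j)] and [(j, i)]. *)
Lemma vector_field_vandermonde2 k :
  vector_field k vandermonde2 = vandermonde2 *
    \sum_(i < n) \sum_(j < n | j != i) divided_difference k i j.
Proof.
rewrite /vandermonde2 (@vector_field_prod_log k _ _ _ _ (fun i : 'I_n =>
  \sum_(j < n | (i < j)%N) (divided_difference k i j + divided_difference k i j))).
  congr (_ * _).
  under eq_bigr do rewrite big_split.
  rewrite big_split/=.
  rewrite [X in _ + X](exchange_big_dep predT)//= -big_split/=.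
  apply: eq_bigr => i _.
  under [X in _ + X]eq_bigr do rewrite divided_differenceC.
  rewrite [RHS](bigID (fun j : 'I_n => (i < j)%N))/=.
  by congr (_ + _); apply: eq_bigl => j; rewrite -(inj_eq val_inj)/=; lia.
move=> i _; apply: vector_field_prod_log => j _.
rewrite vector_field_exp vector_fieldB !vector_fieldX subrXX.
by rewrite -/(divided_difference k i j) /=; ring.
Qed.

Lemma sum_divided_difference k :
  \sum_(i < n) \sum_(j < n) divided_difference k i j =
  \sum_(l < k) power_sum (k.-1 - l) * power_sum l.
Proof.
rewrite /divided_difference.
under eq_bigr do rewrite exchange_big.
rewrite exchange_big/=; apply: eq_bigr => l _.
rewrite /power_sum mulr_suml; apply: eq_bigr => i _.
by rewrite mulr_sumr.
Qed.

Context (a : R) (G : {linear {mpoly R[n]} -> R^o}).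
Hypothesis GX : forall i p, a * G ('X_i * p) = G p^`M(i).

(** Integrate by parts the derivatives in ['X_i] of ['X_i ^+ k * (q * vandermonde2)] and sum over
    [i]. Differentiating ['X_i ^+ k] supplies exactly the diagonal divided differences that the
    Vandermonde factor lacks, so the full double sum factors into power sums. *)
Lemma loop_equation k q :
  a * G (power_sum k.+1 * q * vandermonde2) =
  \sum_(l < k) G (power_sum (k.-1 - l) * power_sum l * q * vandermonde2) +
  G (vector_field k q * vandermonde2).
Proof.
have -> : a * G (power_sum k.+1 * q * vandermonde2) =
    \sum_(i < n) G (('X_i ^+ k * (q * vandermonde2))^`M(i)).
  rewrite /power_sum -mulrA mulr_suml linear_sum mulr_sumr.
  by apply: eq_bigr => i _; rewrite -GX exprS !mulrA.
rewrite -!(linear_sum G) -(linearD G); congr (G _).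
under eq_bigr do rewrite mderivM.
rewrite big_split/= -/(vector_field k (q * vandermonde2)) vector_fieldM.
rewrite vector_field_vandermonde2.
have -> : \sum_(l < k) power_sum (k.-1 - l) * power_sum l * q * vandermonde2 =
    (\sum_(l < k) power_sum (k.-1 - l) * power_sum l) * q * vandermonde2.
  by rewrite !mulr_suml.
rewrite -sum_divided_difference -mulr_suml.
have -> : \sum_(i < n) \sum_(j < n) divided_difference k i j =
    \sum_(i < n) divided_difference k i i +
    \sum_(i < n) \sum_(j < n | j != i) divided_difference k i j.
  by rewrite -big_split; apply: eq_bigr => i _; rewrite (bigD1 i).
have -> : \sum_(i < n) ('X_i ^+ k : {mpoly R[n]})^`M(i) =
    \sum_(i < n) divided_difference k i i.
  apply: eq_bigr => i _; rewrite /divided_difference.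
  have -> : ('X_i ^+ k)^`M(i) = k%:R * 'X_i ^+ k.-1 :> {mpoly R[n]}.
    elim: k => [|m ih]; first by rewrite expr0 mul0r -mpolyC1 mderivC.
    rewrite exprS mderivM ih mderiv_var eqxx mul1r /=.
    case: m {ih} => [|m]; first by rewrite !mul0r mulr0 addr0 mul1r.
    by rewrite /= exprS -[in RHS]natr1; ring.
  rewrite (eq_bigr (fun=> 'X_i ^+ k.-1)); last first.
    move=> l _; rewrite -exprD; congr (_ ^+ _); have := ltn_ord l; lia.
  by rewrite sumr_const card_ord mulr_natl.
by ring.
Qed.

End loop_equation.

(** Leibniz rule indexed by lists: every term is again a product of power sums, as the induction in
    [moment_polynomial] requires. *)
Lemma vector_field_prod_power_sum (R : comNzRingType) n k (s : seq nat) :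
  vector_field k (\prod_(m <- s) power_sum R n m) =
  \sum_(i < size s) (nth 0%N s i)%:R *
     \prod_(m <- ((nth 0%N s i).-1 + k)%N :: take i s ++ drop i.+1 s) power_sum R n m.
Proof.
elim: s => [|m s ih]; first by rewrite big_nil vector_field1 big_ord0.
rewrite big_cons vector_fieldM ih vector_field_power_sum.
rewrite [RHS](@big_ord_recl _ _ _ (size s)) take0 cat0s drop1 big_cons mulrA.
congr (_ + _); rewrite mulr_sumr; apply: eq_bigr => i _.
rewrite -[in RHS]/((nth 0%N s i)%:R * \prod_(m0 <- [:: ((nth 0 s i).-1 + k)%N, m
  & take i s ++ drop i.+1 s]) power_sum R n m0).
by rewrite !big_cons; ring.
Qed.

Definition gaussian_functional (R : comNzRingType) n (a : R)
    (G : {linear {mpoly R[n]} -> R^o}) :=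
  forall i p, a * G ('X_i * p) = G p^`M(i).

(** * The linear functional with prescribed one-variable moments *)

Section moment_functional.
Context (R : comNzRingType) (n : nat) (g : nat -> R).

Definition moment_functional (p : {mpoly R[n]}) : R^o :=
  \sum_(m <- msupp p) p@_m * \prod_(i < n) g (m i).

Lemma moment_functional_bounded p k : (msize p <= k)%N ->
  moment_functional p =
  \sum_(m : 'X_{1..n < k}) p@_m * \prod_(i < n) g ((m : 'X_{1..n}) i).
Proof.
move=> pk; rewrite /moment_functional.
rewrite (ssrcomplements.big_mksub [the subFinType _ of 'X_{1..n < k}]) ?msupp_uniq //=; first last.
  by move=> m /msize_mdeg_lt /leq_trans; apply.
by rewrite big_rmcond //= => j /memN_msupp_eq0 ->; rewrite mul0r.
Qed.

Lemma moment_functional_is_linear : linear moment_functional.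
Proof.
move=> c p q.
pose k := maxn (maxn (msize p) (msize q)) (msize (c *: p + q)).
rewrite !(@moment_functional_bounded _ k) /k; try lia.
rewrite scaler_sumr -big_split; apply: eq_bigr => m _.
by rewrite mcoeffD mcoeffZ /GRing.scale/=; ring.
Qed.

HB.instance Definition _ := GRing.isLinear.Build R {mpoly R[n]} R^o *:%R
  moment_functional moment_functional_is_linear.

Lemma moment_functionalX m :
  moment_functional 'X_[m] = \prod_(i < n) g (m i).
Proof. by rewrite /moment_functional msuppX big_seq1 mcoeffX eqxx mul1r. Qed.

Context (a : R) (g1 : g 1 = 0).
Hypothesis gSS : forall k, a * g k.+2 = k.+1%:R * g k.

Lemma gaussian_moment_functional : gaussian_functional a moment_functional.
Proof.
move=> i p; elim/mpolyind: p => [|c m p _ _ ih].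
  by rewrite mulr0 mderiv0 !linear0 mulr0.
rewrite mulrDr mderivD !linearD mulrDr ih; congr (_ + _).
rewrite -scalerAr mderivZ !linearZ/= /GRing.scale/= mulrCA; congr (_ * _).
rewrite -mpolyXD mderivX linearZ/= !moment_functionalX.
rewrite (bigD1 i)//= [in RHS](bigD1 i)//= mnmDE mnm1E eqxx mnmBE mnm1E eqxx.
have -> : \prod_(j < n | j != i) g ((U_(i) + m)%MM j) =
    \prod_(j < n | j != i) g ((m - U_(i))%MM j).
  apply: eq_bigr => j ji.
  by rewrite mnmDE mnmBE mnm1E eq_sym (negbTE ji) add0n subn0.
rewrite mulrA /GRing.scale/= mulrA; congr (_ * _).
(* Exponent [0] is where [g 1 = 0] enters: the derivative side carries the factor [0]. *)
case: (m i) => [|k]; first by rewrite addn0 g1 mulr0 mul0r.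
by rewrite add1n gSS subn1.
Qed.

End moment_functional.

(** Iterated loop equations; [P] is chosen before [n], [a] and [G], which is the polynomial
    dependence on [n]. A loop equation lowers the total degree by 2 and lengthens the list by at
    most one, while an entry [0] is removed as a factor [n]; hence the measure
    [2 * sumn s + size s]. Each equation consumes one factor [a], and [uphalf] leaves one also in
    total degree 1. *)
Lemma moment_polynomial (R : comNzRingType) (s : seq nat) :
  exists P : {poly R}, forall n a G, gaussian_functional (n := n) a G ->
    a ^+ uphalf (sumn s) * G ((\prod_(m <- s) power_sum R n m) * vandermonde2 R n) =
    P.[n%:R] * G (vandermonde2 R n).
Proof.
have [d] := ubnP (2 * sumn s + size s)%N.
elim: d s => // d ih [|[|k] s] hd.
- by exists 1 => n a G _; rewrite big_nil !mul1r hornerC mul1r.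
- have [|P hP] := ih s; first by move: hd => /=; lia.
  exists ('X * P) => n a G hG.
  rewrite big_cons hornerM hornerX -[RHS]mulrA -(hP n a G hG).
  have -> : power_sum R n 0 = n%:R.
    rewrite /power_sum (eq_bigr (fun=> 1)) => [|i _]; last by rewrite expr0.
    by rewrite sumr_const card_ord.
  by rewrite -mulrA mulr_natl linearMn mulrnAr mulr_natl.
(* One term of the loop equation with integer coefficient [c]. The alternative [c = 0] covers zero
   entries of [s], for which the degree count fails because [0.-1 = 0]. *)
- have hS (t : seq nat) (c : nat) : (c == 0%N) ||
        ((sumn t).+2 == (k.+1 + sumn s)%N) && (size t <= (size s).+2)%N ->
      exists P : {poly R}, forall n a G, gaussian_functional (n := n) a G ->
        c%:R * a ^+ (uphalf (k.+1 + sumn s)).-1 *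
          G ((\prod_(m <- t) power_sum R n m) * vandermonde2 R n) =
        P.[n%:R] * G (vandermonde2 R n).
    case/orP => [/eqP ->|/andP[/eqP e st]].
      by exists 0 => n a G _; rewrite horner0 !mul0r.
    have [|P hP] := ih t; first by move: hd => /=; lia.
    rewrite -e.
    exists (c%:R * P) => n a G hG; rewrite hornerM -mulrA hP//.
    by rewrite -[c%:R in RHS]polyCMn hornerC mulrA.
  have [P1 hP1] : exists P1 : 'I_k -> {poly R}, forall (l : 'I_k) n a G,
      gaussian_functional (n := n) a G ->
      a ^+ (uphalf (k.+1 + sumn s)).-1 *
        G (power_sum R n (k.-1 - l) * power_sum R n l *
           (\prod_(m <- s) power_sum R n m) * vandermonde2 R n) =
      (P1 l).[n%:R] * G (vandermonde2 R n).
    apply: (@fin_all_exists _ (fun=> {poly R}) (fun l P => forall n a G,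
      gaussian_functional (n := n) a G -> _ = P.[n%:R] * _)) => l.
    have [|P hP] := hS [:: (k.-1 - l)%N, nat_of_ord l & s] 1%N.
      by apply/orP; right => /=; have := ltn_ord l; lia.
    exists P => n a G hG; rewrite -(hP n a G hG) mul1r.
    by rewrite !big_cons !mulrA.
  have [P2 hP2] : exists P2 : 'I_(size s) -> {poly R}, forall (l : 'I_(size s)) n a G,
      gaussian_functional (n := n) a G ->
      a ^+ (uphalf (k.+1 + sumn s)).-1 * ((nth 0%N s l)%:R *
        G ((\prod_(m <- ((nth 0%N s l).-1 + k)%N :: take l s ++ drop l.+1 s)
              power_sum R n m) * vandermonde2 R n)) =
      (P2 l).[n%:R] * G (vandermonde2 R n).
    apply: (@fin_all_exists _ (fun=> {poly R}) (fun l P => forall n a G,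
      gaussian_functional (n := n) a G -> _ = P.[n%:R] * _)) => l.
    have [|P hP] := hS (((nth 0%N s l).-1 + k)%N :: take l s ++ drop l.+1 s)
                       (nth 0%N s l).
      have -> : sumn s = (sumn (take l s ++ drop l.+1 s) + nth 0%N s l)%N.
        rewrite -{1}(cat_take_drop l s) (drop_nth 0%N)// !sumn_cat/=; lia.
      have : (size (take l s ++ drop l.+1 s) <= size s)%N.
        by rewrite size_cat size_take size_drop ltn_ord; have := ltn_ord l; lia.
      by rewrite /=; case: (nth 0%N s l) => [//|m] /=; lia.
    by exists P => n a G hG; rewrite -(hP n a G hG); ring.
  exists (\sum_l P1 l + \sum_l P2 l) => n a G hG.
  rewrite hornerD !horner_sum mulrDl !mulr_suml.
  under [X in _ = X + _]eq_bigr do rewrite -(hP1 _ n a G hG).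
  under [X in _ = _ + X]eq_bigr do rewrite -(hP2 _ n a G hG).
  rewrite -!mulr_sumr -mulrDr big_cons /=.
  rewrite exprSr -mulrA (loop_equation hG) /=; congr (_ * (_ + _)).
  rewrite vector_field_prod_power_sum mulr_suml linear_sum.
  by apply: eq_bigr => l _; rewrite -mulrA [X in G X]mulr_natl linearMn mulr_natl.
Qed.

(* [F] is a polynomial function with [c] its value under the linear functional
   sending a monomial to the product of the moments [g] of its variables. *)
Definition has_moment (R : comNzRingType) n (g : nat -> R)
    (F : ('I_n -> R) -> R) (c : R) :=
  exists e : seq (R * ('I_n -> nat)),
    (forall v, F v = \sum_(t <- e) t.1 * \prod_(i < n) v i ^+ t.2 i) /\
    c = \sum_(t <- e) t.1 * \prod_(i < n) g (t.2 i).

Lemma has_moment_meval (R : comNzRingType) n (g : nat -> R) (p : {mpoly R[n]})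
    F : (forall v, p.@[v] = F v) -> has_moment g F (moment_functional g p).
Proof.
move=> pF; exists [seq (p@_m, fun i => m i) | m <- msupp p].
by split => [v|]; rewrite big_map//= -pF mevalE.
Qed.

(** The form suited to integrals: polynomials become functions, and the functional becomes any
    sequence [g] obeying the Gaussian recursion. *)
Lemma vandermonde2_moment_polynomial (R : comNzRingType) (s : seq nat) :
  exists P : {poly R}, forall n (a : R) (g : nat -> R),
    g 1 = 0 -> (forall k, a * g k.+2 = k.+1%:R * g k) ->
    let V := fun v : 'I_n -> R =>
      \prod_(j < n) \prod_(k < n | (j < k)%N) (v j - v k) ^+ 2 in
    exists M0 M, [/\ has_moment g V M0,
      has_moment g (fun v => (\prod_(m <- s) \sum_(i < n) v i ^+ m) * V v) M &
      a ^+ uphalf (sumn s) * M = P.[n%:R] * M0].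
Proof.
have [P hP] := moment_polynomial R s; exists P => n a g g1 gSS V.
have hV v : (vandermonde2 R n).@[v] = V v.
  rewrite /vandermonde2 rmorph_prod; apply: eq_bigr => j _.
  rewrite rmorph_prod; apply: eq_bigr => k _.
  by rewrite rmorphXn rmorphB/= !mevalXU.
exists (moment_functional g (vandermonde2 R n)).
exists (moment_functional g ((\prod_(m <- s) power_sum R n m) * vandermonde2 R n)).
split.
- exact: has_moment_meval.
- apply: has_moment_meval => v; rewrite rmorphM/= hV rmorph_prod; congr (_ * _).
  apply: eq_bigr => m _; rewrite rmorph_sum; apply: eq_bigr => i _.
  by rewrite rmorphXn/= mevalXU.
- exact/hP/gaussian_moment_functional.
Qed.

End LoopEquations.

From mathcomp Require Import all_classical all_reals all_analysis.
From mathcomp Require Import measurable_realfun.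

Import numFieldNormedType.Exports.

Local Open Scope classical_set_scope.
Local Open Scope ring_scope.

(** * Moments of the one-dimensional Gaussian weight *)

Lemma integrableZ_EFin d (T : measurableType d) (R : realType)
    (mu : {measure set T -> \bar R}) (D : set T) (k : R) (f : T -> R) :
  measurable D -> mu.-integrable D (EFin \o f) ->
  mu.-integrable D (EFin \o (fun x => k * f x)).
Proof. by move=> mD /(integrableZl mD k). Qed.

Section gaussian_moments.
Context {R : realType}.
Notation mu := (@lebesgue_measure R).

Definition gaussian_monomial (a : R) (k : nat) (x : R) : R :=
  x ^+ k * expR (- (a * (x ^+ 2 / 2))).

Lemma exprn_le_fact_expR (y : R) k : 0 <= y -> y ^+ k <= k`!%:R * expR y.
Proof.
case: k => [|k] y0; first by rewrite expr0 fact0 mul1r -expR0 ler_expR.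
have := expR_ge1Dxn k y0; set e := expR y => h.
rewrite mulrC -ler_pdivrMr ?ltr0n ?fact_gt0//.
by apply: le_trans h; rewrite lerDr ler01.
Qed.

(** Half of the Gaussian decay absorbs the monomial: with [y = a x^2 / 4] the weight is [exp (-y)]
    squared, and one factor bounds [|x^k| <= 1 + x^(2k)]. *)
Lemma gaussian_monomial_bound (a : R) k : 0 < a ->
  exists2 C, 0 <= C & forall x,
    `|gaussian_monomial a k x| <= C * expR (- (a / 4 * x ^+ 2)).
Proof.
move=> a0; exists (1 + (4 / a) ^+ k * k`!%:R).
  by rewrite addr_ge0 ?ler01// mulr_ge0 ?ler0n// exprn_ge0// divr_ge0// ltW.
move=> x; rewrite /gaussian_monomial normrM (ger0_norm (expR_ge0 _)).
set y := a / 4 * x ^+ 2.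
have y0 : 0 <= y by rewrite mulr_ge0 ?sqr_ge0// divr_ge0// ltW.
have -> : expR (- (a * (x ^+ 2 / 2))) = expR (- y) * expR (- y).
  by rewrite -expRD; congr expR; rewrite /y; field.
rewrite mulrA ler_wpM2r ?expR_ge0//.
have hk : `|x ^+ k| <= 1 + (x ^+ 2) ^+ k.
  rewrite -exprM mulnC exprM -[(x ^+ k) ^+ 2]real_normK ?num_real//.
  move: (`|x ^+ k|) (normr_ge0 (x ^+ k)) => t t0; nra.
have hx2 : (x ^+ 2) ^+ k = (4 / a) ^+ k * y ^+ k.
  rewrite -exprMn; congr (_ ^+ _); rewrite /y; field; exact: lt0r_neq0.
have h1 : 1 <= expR y by rewrite -expR0 ler_expR.
have h2 : (x ^+ 2) ^+ k <= (4 / a) ^+ k * k`!%:R * expR y.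
  rewrite hx2 -mulrA ler_wpM2l ?exprn_ge0 ?divr_ge0 ?(ltW a0)//.
  exact: exprn_le_fact_expR.
rewrite expRN -ler_pdivlMr ?invr_gt0 ?expR_gt0// invrK mulrDl mul1r.
by rewrite (le_trans hk)// lerD.
Qed.

Lemma continuous_gaussian_monomial a k : continuous (gaussian_monomial a k).
Proof.
move=> x; apply: cvgM; first exact: exprn_continuous.
apply: continuous_comp; last exact: continuous_expR.
apply: cvgN; apply: cvgM; first exact: cvg_cst.
apply: cvgM; last exact: cvg_cst.
exact: exprn_continuous.
Qed.

Lemma measurable_gaussian_monomial a k :
  measurable_fun setT (gaussian_monomial a k).
Proof.
by apply: continuous_measurable_fun; exact: continuous_gaussian_monomial.
Qed.

Lemma integrable_gaussian_monomial (a : R) k : 0 < a ->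
  mu.-integrable setT (EFin \o gaussian_monomial a k).
Proof.
move=> a0; have [C C0 hC] := gaussian_monomial_bound k a0.
(* Variance [2 / a] makes the normal density proportional to [exp (- a x^2 / 4)]. *)
pose s := Num.sqrt (2 / a).
have s0 : s != 0 by rewrite gt_eqF// sqrtr_gt0 divr_gt0.
pose g x := C * (normal_peak s)^-1 * normal_pdf 0 s x.
have ig : mu.-integrable setT (EFin \o g).
  rewrite (_ : EFin \o g = fun x => ((C * (normal_peak s)^-1)%:E *
    (normal_pdf 0 s x)%:E)%E); last by apply/funext => x; rewrite -EFinM.
  by apply: integrableZl => //; exact: integrable_normal_pdf.
apply: le_integrable ig => //.
  by apply/measurable_EFinP; exact: measurable_gaussian_monomial.
move=> x _ /=; rewrite lee_fin (le_trans (hC x))// (le_trans _ (ler_norm _))//.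
rewrite /g normal_pdfE// /normal_fun -!mulrA ler_wpM2l//.
rewrite mulKf ?gt_eqF ?normal_peak_gt0// le_eqVlt; apply/orP; left.
apply/eqP; congr expR; rewrite /s sqr_sqrtr ?divr_ge0 ?ltW// subr0.
by field; exact: lt0r_neq0.
Qed.

(** The monomial with one more power of [x] is still bounded, so dividing by [n] gives the limit;
    [s = 1] and [s = -1] serve the two ends of the line. *)
Lemma cvg_gaussian_monomial_nat (a : R) k (s : R) : 0 < a -> `|s| = 1 ->
  gaussian_monomial a k (s * n%:R) @[n --> \oo] --> 0.
Proof.
move=> a0 s1; have [C C0 hC] := gaussian_monomial_bound k.+1 a0.
apply/norm_cvg0P; apply/cvgrPdist_le => e e0; near=> n.
rewrite sub0r normrN normr_id.
have n0 : 0 < n%:R :> R by rewrite ltr0n; near: n; exact: nbhs_infty_gt.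
have -> : `|gaussian_monomial a k (s * n%:R)| =
    `|gaussian_monomial a k.+1 (s * n%:R)| / n%:R.
  have -> : gaussian_monomial a k.+1 (s * n%:R) =
      s * n%:R * gaussian_monomial a k (s * n%:R).
    by rewrite /gaussian_monomial (exprS _ k) !mulrA.
  rewrite (normrM (s * n%:R)) (normrM s) s1 mul1r (ger0_norm (ltW n0)).
  by rewrite mulrAC divff ?mul1r// gt_eqF.
rewrite ler_pdivrMr// (le_trans (hC _))// (@le_trans _ _ C)//.
  rewrite ler_piMr// expR_le1 oppr_le0 mulr_ge0 ?sqr_ge0//.
  by rewrite divr_ge0// ltW.
rewrite mulrC -ler_pdivrMr//; near: n; exact: nbhs_infty_ger.
Unshelve. all: by end_near. Qed.

(** The integral over [[-n, n]] tends to the full integral by dominated convergence and equals a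
    difference of boundary values, which tends to 0. *)
Lemma integral_derivative_eq0 (F f : R -> R) :
  continuous f -> (forall x : R, is_derive x 1 F (f x)) ->
  mu.-integrable setT (EFin \o f) ->
  F n%:R @[n --> \oo] --> (0 : R) -> F (- n%:R) @[n --> \oo] --> (0 : R) ->
  \int[mu]_x f x = 0.
Proof.
move=> cf dF intf F1 F2.
have mf : measurable_fun setT f by exact: continuous_measurable_fun.
pose f_ n := (EFin \o f) \_ `[- n%:R, n%:R].
have lim1 : (\int[mu]_x f_ n x)%E @[n --> \oo] --> (\int[mu]_x (f x)%:E)%E.
  apply: (@dominated_cvg _ _ _ mu setT _ f_ (EFin \o f) (abse \o (EFin \o f))) => //.
  - move=> n; apply/measurable_restrict => //.
    by rewrite setTI; apply/measurable_EFinP; exact: measurable_funS mf.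
  - move=> x _; apply: cvg_near_cst; near=> n.
    rewrite /f_ patchE mem_set//= in_itv/= -ler_norml.
    by near: n; exact: nbhs_infty_ger.
  - exact: integrable_abse.
  - by move=> n x _; rewrite /f_ patchE; case: ifP => //= _; rewrite normr0 lee_fin.
have lim2 : (\int[mu]_x f_ n x)%E @[n --> \oo] --> (0%:E : \bar R).
  apply: (@cvg_trans _ ((F n%:R - F (- n%:R))%:E @[n --> \oo])).
    apply: near_eq_cvg; near=> n.
    rewrite /f_ -integral_mkcond.
    rewrite (@continuous_FTC2 _ f F)//.
    - by rewrite gtrN// ltr0n; near: n; exact: nbhs_infty_gt.
    - exact: continuous_subspaceT.
    - have cF : continuous F.
        move=> x; apply: differentiable_continuous; apply/derivable1_diffP.
        by have := dF x; case.
      split.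
      + by move=> x _; have := dF x; case.
      + exact/cvg_at_right_filter/cF.
      + exact/cvg_at_left_filter/cF.
    - by move=> x _; rewrite derive1E; have := dF x; case.
  apply: cvg_EFin; first by near=> n.
  by rewrite -[0]subr0; exact: cvgB.
have := cvg_unique _ lim1 lim2; rewrite /Rintegral => ->//.
Unshelve. all: by end_near. Qed.

Definition gaussian_moment (a : R) k := \int[mu]_x gaussian_monomial a k x.

Lemma is_derive_gaussian_monomial0 (a : R) (x : R) :
  is_derive x 1 (gaussian_monomial a 0) ((- a) * gaussian_monomial a 1 x).
Proof.
have dp := is_derive_poly (- (a / 2) *: 'X^2) x.
have := @is_derive1_comp _ expR _ _ _ _ (is_derive_expR _) dp.
rewrite (_ : expR \o _ = gaussian_monomial a 0); last first.
  apply/funext => y; rewrite /gaussian_monomial /= expr0 mul1r hornerZ hornerXn.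
  by congr expR; field.
move/is_derive_eq; apply.
rewrite /gaussian_monomial derivZ derivXn !hornerZ hornerMn !hornerXn.
rewrite (_ : - (a / 2) * x ^+ 2 = - (a * (x ^+ 2 / 2))); last by field.
by field.
Qed.

Lemma is_derive_gaussian_monomialS (a : R) k (x : R) :
  is_derive x 1 (gaussian_monomial a k.+1)
    (k.+1%:R * gaussian_monomial a k x - a * gaussian_monomial a k.+2 x).
Proof.
have dp := is_derive_poly 'X^(k.+1) x.
have := is_deriveM dp (is_derive_gaussian_monomial0 a x).
rewrite (_ : _ * _ = gaussian_monomial a k.+1); last first.
  apply/funext => y; rewrite -[LHS]/(('X^(k.+1)).[y] * gaussian_monomial a 0 y).
  by rewrite /gaussian_monomial expr0 mul1r hornerXn.
move/is_derive_eq; apply.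
rewrite /gaussian_monomial /GRing.scale/= derivXn hornerMn !hornerXn !exprS.
ring.
Qed.

Lemma gaussian_moment1 (a : R) : 0 < a -> gaussian_moment a 1 = 0.
Proof.
move=> a0.
have := @integral_derivative_eq0 (gaussian_monomial a 0)
  (fun x => (- a) * gaussian_monomial a 1 x).
rewrite RintegralZl//; last exact: integrable_gaussian_monomial.
move=> h; apply: (@mulfI _ (- a)); first by rewrite oppr_eq0 gt_eqF.
rewrite mulr0; apply: h.
- by move=> x; apply: cvgM; [exact: cvg_cst|exact: continuous_gaussian_monomial].
- exact: is_derive_gaussian_monomial0.
- apply: (@integrableZ_EFin _ _ _ _ _ (- a)) => //; exact: integrable_gaussian_monomial.
- have := @cvg_gaussian_monomial_nat a 0 1 a0 (normr1 _).
  by under eq_cvg do rewrite mul1r.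
- have := @cvg_gaussian_monomial_nat a 0 (-1) a0 (normrN1 _).
  by under eq_cvg do rewrite mulN1r.
Qed.

(** The derivative of [gaussian_monomial a k.+1] integrates to 0; this is the recursion assumed of
    [g] in the loop equations. *)
Lemma gaussian_momentSS (a : R) k : 0 < a ->
  a * gaussian_moment a k.+2 = k.+1%:R * gaussian_moment a k.
Proof.
move=> a0.
have i1 : mu.-integrable setT (EFin \o (fun x => k.+1%:R * gaussian_monomial a k x)).
  by apply: (@integrableZ_EFin _ _ _ _ _ k.+1%:R) => //; exact: integrable_gaussian_monomial.
have i2 : mu.-integrable setT (EFin \o (fun x => a * gaussian_monomial a k.+2 x)).
  by apply: (@integrableZ_EFin _ _ _ _ _ a) => //; exact: integrable_gaussian_monomial.
have := @integral_derivative_eq0 (gaussian_monomial a k.+1)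
  (fun x => k.+1%:R * gaussian_monomial a k x - a * gaussian_monomial a k.+2 x).
rewrite RintegralB// !RintegralZl//; try exact: integrable_gaussian_monomial.
move=> h; apply/eqP; rewrite eq_sym -subr_eq0; apply/eqP; apply: h.
- move=> x; apply: cvgB; apply: cvgM; by [exact: cvg_cst|exact: continuous_gaussian_monomial].
- exact: is_derive_gaussian_monomialS.
- exact: (integrableB _ i1 i2).
- have := @cvg_gaussian_monomial_nat a k.+1 1 a0 (normr1 _).
  by under eq_cvg do rewrite mul1r.
- have := @cvg_gaussian_monomial_nat a k.+1 (-1) a0 (normrN1 _).
  by under eq_cvg do rewrite mulN1r.
Qed.

End gaussian_moments.

(** * Integration over tuples *)

Lemma Rintegral_lincomb d (T : measurableType d) (R : realType)
    (mu : {measure set T -> \bar R}) (I : Type) (e : seq I) (c : I -> R)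
    (f : I -> T -> R) :
  (forall i, mu.-integrable setT (EFin \o f i)) ->
  mu.-integrable setT (EFin \o (fun z => \sum_(i <- e) c i * f i z)) /\
  \int[mu]_z (\sum_(i <- e) c i * f i z) = \sum_(i <- e) c i * \int[mu]_z f i z.
Proof.
move=> fi; elim: e => [|i e [ih1 ih2]].
  rewrite (_ : (fun=> _) = cst 0); last by apply/funext => z; rewrite big_nil.
  by split; [exact: integrable0|rewrite /Rintegral integral0 big_nil].
have h := integrableZ_EFin (c i) measurableT (fi i).
rewrite (_ : (fun z => _) = (fun z =>
    c i * f i z + \sum_(i <- e) c i * f i z));
  last by apply/funext => z; rewrite big_cons.
split; first exact: (integrableD measurableT h ih1).
by rewrite RintegralD// ih2 RintegralZl// big_cons.
Qed.

Section tuple_integral.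
Context {R : realType}.
Local Notation T := (measurableTypeR R).
Local Notation mu := (@lebesgue_measure R).

(** The nonnegative case, applied to absolute values, supplies the finiteness needed for
    integrability in the next lemma. *)
Lemma ge0_integral_lebesgue_tupleS n (f : n.+1.-tuple T -> \bar R) :
  measurable_fun setT f -> (forall z, 0 <= f z)%E ->
  (\int[lebesgue_tuple R n.+1]_z f z =
   \int[(mu \x lebesgue_tuple R n)%E]_p f (consp p))%E.
Proof.
move=> mf f0.
have := @ge0_integral_pushforward _ _ _ _ R (@consp _ T n) (@measurable_consp _ T n)
  (mu \x lebesgue_tuple R n)%E setT f measurableT mf (fun z _ => f0 z).
rewrite preimage_setT => <-.
by apply: eq_measure_integral => [|A mA sA]; first exact: measurable_consp.
Qed.

Lemma integral_lebesgue_tupleS n (f : n.+1.-tuple T -> \bar R) :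
  measurable_fun setT f ->
  (mu \x lebesgue_tuple R n)%E.-integrable setT (f \o @consp _ T n) ->
  (lebesgue_tuple R n.+1).-integrable setT f /\
  (\int[lebesgue_tuple R n.+1]_z f z =
   \int[(mu \x lebesgue_tuple R n)%E]_p f (consp p))%E.
Proof.
move=> mf fi; split.
  apply/integrableP; split => //.
  rewrite ge0_integral_lebesgue_tupleS//; last exact: measurableT_comp.
  by have /integrableP[] := fi.
have := @integral_pushforward _ _ _ _ R (@consp _ T n) (@measurable_consp _ T n)
  (mu \x lebesgue_tuple R n)%E setT f mf.
rewrite preimage_setT => /(_ fi measurableT) <-.
by apply: eq_measure_integral => [|A mA sA]; first exact: measurable_consp.
Qed.

Lemma measurable_tuple_prod n (g : 'I_n -> R -> R) :
  (forall i, measurable_fun setT (g i)) ->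
  measurable_fun setT (fun z : n.-tuple T => \prod_(i < n) g i (tnth z i)).
Proof.
move=> mg; apply: measurable_prod => i _.
by apply: (measurableT_comp (mg i)); exact: measurable_tnth.
Qed.

(** Induction on the dimension by Fubini, with integrability checked on iterated integrals of
    absolute values. In dimension 0 the measure is a Dirac mass, matching the empty product. *)
Lemma integral_tuple_prod n (g : 'I_n -> R -> R) :
  (forall i, mu.-integrable setT (EFin \o g i)) ->
  (lebesgue_tuple R n).-integrable setT
    (fun z => (\prod_(i < n) g i (tnth z i))%:E) /\
  \int[lebesgue_tuple R n]_z (\prod_(i < n) g i (tnth z i)) =
  \prod_(i < n) \int[mu]_x g i x.
Proof.
elim: n g => [|n ih] g ig.
  have h : forall z : 0.-tuple T, (\prod_(i < 0) g i (tnth z i))%:E = 1%E :> \bar R.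
    by move=> z; rewrite big_ord0.
  split.
    apply/integrableP; split.
      by rewrite (_ : (fun z => _) = cst 1%E); [exact: measurable_cst|apply/funext].
    under eq_integral do rewrite h abse1.
    by rewrite /= integral_dirac// diracT mul1e ltry.
  rewrite big_ord0 /Rintegral; under eq_integral do rewrite h.
  by rewrite /= integral_dirac// diracT mul1e.
have mg i : measurable_fun setT (g i).
  by have /integrableP[/measurable_EFinP] := ig i.
pose h (z : n.-tuple T) := \prod_(i < n) g (lift ord0 i) (tnth z i).
have mh : measurable_fun setT h.
  by apply: (@measurable_tuple_prod n (fun i => g (lift ord0 i))) => i; exact: mg.
have [ih1 ih2] := ih (fun i => g (lift ord0 i)) (fun i => ig _).
have hE (p : T * n.-tuple T) :
    \prod_(i < n.+1) g i (tnth (consp p) i) = g ord0 p.1 * h p.2.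
  rewrite big_ord_recl; congr (_ * _).
  by apply: eq_bigr => i _; congr (g _ _); rewrite tnthS.
have mprod : measurable_fun setT
    (fun p : T * n.-tuple T => (g ord0 p.1 * h p.2)%:E).
  apply/measurable_EFinP; apply: measurable_funM.
    by apply: (measurableT_comp (mg ord0)); exact: measurable_fst.
  by apply: (measurableT_comp mh); exact: measurable_snd.
have iprod : (mu \x lebesgue_tuple R n)%E.-integrable setT
    (fun p : T * n.-tuple T => (g ord0 p.1 * h p.2)%:E).
  apply/integrable12ltyP => //=.
  under eq_integral => x _.
    under eq_integral do rewrite normrM EFinM.
    rewrite ge0_integralZl//; last first.
      by apply/measurable_EFinP; apply: measurableT_comp => //; exact: measurable_tuple_prod.
    over.
  have /integrableP[_ fi1] := ih1; have /integrableP[_ fi0] := ig ord0.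
  rewrite /= ge0_integralZr//; last 2 first.
    by have /integrableP[mabs _] := integrable_abse (ig ord0); exact: mabs.
    exact: integral_ge0.
  apply: lte_mul_pinfty => //; first exact: integral_ge0.
  by rewrite ge0_fin_numE//; exact: integral_ge0.
have mf : measurable_fun setT
    (fun z : n.+1.-tuple T => (\prod_(i < n.+1) g i (tnth z i))%:E).
  by apply/measurable_EFinP; exact: measurable_tuple_prod.
have [|i1 i2] := @integral_lebesgue_tupleS n _ mf.
  by apply: eq_integrable iprod => // p _ /=; rewrite hE.
split => //.
rewrite big_ord_recl -ih2 /Rintegral i2.
under [X in fine X = _]eq_integral do rewrite hE.
rewrite -integral12_prod_meas1// /fubini_F/=.
under eq_integral => x _.
  under eq_integral do rewrite EFinM.
  rewrite integralZl//.
  over.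
rewrite /= -fineM ?integrable_fin_num//; last exact: ig.
have -> : (\int[lebesgue_tuple R n]_x (\prod_(i < n) g (lift ord0 i) (tnth x i))%:E)%E
    = (fine (\int[lebesgue_tuple R n]_x (h x)%:E))%:E.
  by rewrite fineK//; exact: integrable_fin_num.
congr fine.
rewrite -integralZr//; last exact: ig.
Qed.

End tuple_integral.

(** * Expectations under the Gaussian ensemble *)

Section gaussian_ensemble.
Context {R : realType}.
Local Notation T := (measurableTypeR R).
Local Notation mu := (@lebesgue_measure R).

Definition gaussian_weight n (a : R) (z : n.-tuple T) : R :=
  \prod_(j < n) expR (- (a * (tnth z j ^+ 2 / 2))).

Definition squared_vandermonde n (v : 'I_n -> R) : R :=
  \prod_(j < n) \prod_(k < n | (j < k)%N) (v j - v k) ^+ 2.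

Lemma squared_vandermonde_ge0 n (v : 'I_n -> R) : 0 <= squared_vandermonde v.
Proof. by apply: prodr_ge0 => j _; apply: prodr_ge0 => k _; exact: sqr_ge0. Qed.

Lemma gaussian_weight_ge0 n a (z : n.-tuple T) : 0 <= gaussian_weight a z.
Proof. by apply: prodr_ge0 => j _; exact: expR_ge0. Qed.

(** Expanding [F] into monomials makes the integrand a combination of products over the coordinates,
    so the formal value [c] is an actual integral. *)
Lemma has_moment_integral n (a : R) F c : 0 < a ->
  LoopEquations.has_moment (gaussian_moment a) F c ->
  (lebesgue_tuple R n).-integrable setT
    (EFin \o (fun z => F (tnth z) * gaussian_weight a z)) /\
  \int[lebesgue_tuple R n]_z (F (tnth z) * gaussian_weight a z) = c.
Proof.
move=> a0 [e [hF ->]].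
have -> : (fun z => F (tnth z) * gaussian_weight a z) = (fun z : n.-tuple T =>
    \sum_(t <- e) t.1 * \prod_(i < n) gaussian_monomial a (t.2 i) (tnth z i)).
  apply/funext => z; rewrite hF mulr_suml; apply: eq_bigr => t _.
  by rewrite -mulrA /gaussian_weight -big_split.
have h t := @integral_tuple_prod R n (fun i => gaussian_monomial a (t i))
   (fun i => integrable_gaussian_monomial (t i) a0).
have [h1 h2] := Rintegral_lincomb e (fun t => t.1) (fun t => (h t.2).1).
split => //; rewrite h2; apply: eq_bigr => t _.
by have [_ ->] := h t.2.
Qed.

(** On the box with sides [[2i, 2i+1]] the coordinates are at least 1 apart, so the Vandermonde
    factor is at least 1; off the box the left side is 0. The minorant is a product over coordinates
    and can be integrated explicitly. *)
Lemma gaussian_vandermonde_lower_bound n (a : R) (z : n.-tuple T) : 0 < a ->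
  \prod_(i < n) (expR (- (a * ((i.*2.+1)%:R ^+ 2 / 2))) *
     \1_(`[(i.*2)%:R, (i.*2.+1)%:R] : set R) (tnth z i)) <=
  squared_vandermonde (tnth z) * gaussian_weight a z.
Proof.
move=> a0.
have [/forallP zin|] := boolP [forall i : 'I_n,
    (i.*2)%:R <= tnth z i <= (i.*2.+1)%:R]; last first.
  rewrite negb_forall => /existsP[i zi].
  rewrite (bigD1 i)//= indicE memNset ?mulr0 ?mul0r; last first.
    by rewrite /= in_itv/=; exact/negP.
  by rewrite mulr_ge0 ?squared_vandermonde_ge0 ?gaussian_weight_ge0.
have V1 : 1 <= squared_vandermonde (tnth z).
  apply: (big_ind (fun x => 1 <= x)) => // [x y|j _]; first exact: mulr_ege1.
  apply: (big_ind (fun x => 1 <= x)) => // [x y|k jk]; first exact: mulr_ege1.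
  have /andP[_ zj] := zin j; have /andP[zk _] := zin k.
  have : (j.*2.+2 <= k.*2)%N by rewrite -doubleS leq_double.
  rewrite -(ler_nat R) -natr1 => jk2.
  have : 1 <= tnth z k - tnth z j by lra.
  by move: (tnth z j) (tnth z k) => x y; nra.
rewrite (@le_trans _ _ (gaussian_weight a z))//; last first.
  by rewrite ler_peMl// gaussian_weight_ge0.
apply: ler_prod => i _; rewrite indicE mem_set ?mulr1; last by rewrite /= in_itv/= zin.
rewrite expR_ge0 ler_expR lerN2 (ler_wpM2l (ltW a0))// ler_wpM2r ?invr_ge0//.
have /andP[z1 z2] := zin i.
have : 0 <= (i.*2)%:R :> R by [].
by move: (tnth z i) (_%:R) (_%:R) z1 z2 => x b c; nra.
Qed.

Lemma gaussian_vandermonde_gt0 n (a M0 : R) : 0 < a ->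
  LoopEquations.has_moment (gaussian_moment a) (@squared_vandermonde n) M0 ->
  0 < M0.
Proof.
move=> a0 /(has_moment_integral a0)[i0 <-].
pose g (i : 'I_n) (x : R) := expR (- (a * ((i.*2.+1)%:R ^+ 2 / 2))) *
  \1_(`[(i.*2)%:R, (i.*2.+1)%:R] : set R) x.
have ig i : mu.-integrable setT (EFin \o g i).
  apply: integrableZ_EFin => //; exact: integrable_indic_itv.
have [h1 h2] := integral_tuple_prod ig.
apply: lt_le_trans (le_Rintegral measurableT h1 i0 (fun z _ => _)); last first.
  by move=> z _; exact: gaussian_vandermonde_lower_bound.
rewrite h2; apply: prodr_gt0 => i _.
rewrite /g RintegralZl//; last exact: integrable_indic_itv.
rewrite mulr_gt0 ?expR_gt0// /Rintegral integral_indic//=.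
rewrite setIT lebesgue_measure_itv/= lte_fin ltr_nat ltnSn -EFinB/=.
by rewrite subr_gt0 ltr_nat.
Qed.

End gaussian_ensemble.

(** * Taylor estimates for the exponential and the logarithm *)

Section taylor_estimates.
Context {R : realType}.

Lemma derive_ge0_le (f df : R -> R) (y : R) :
  (forall x : R, is_derive x 1 f (df x)) ->
  (forall x, 0 <= x -> 0 <= df x) -> 0 <= y -> f 0 <= f y.
Proof.
move=> dfE df0; rewrite le_eqVlt => /orP[/eqP <-//|y0].
have cf x : {for x, continuous f}.
  apply: differentiable_continuous; apply/derivable1_diffP.
  by have := dfE x; case.
have [|x] := @MVT R f df 0 y y0 (fun x _ => dfE x).
  by apply: continuous_subspaceT => x; exact: cf.
rewrite in_itv/= => /andP[x0 _] e; rewrite -subr_ge0 e mulr_ge0 ?df0 ?ltW//.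
by rewrite subr0.
Qed.

Definition expN_taylor k : {poly R} := \poly_(j < k) ((-1) ^+ j / j`!%:R).

Lemma deriv_expN_taylor k : (expN_taylor k.+1)^`() = - expN_taylor k.
Proof.
apply/polyP => i; rewrite coef_deriv coefN !coef_poly ltnS.
case: ifP => _; last by rewrite oppr0 mul0rn.
rewrite factS natrM -mulr_natr exprS invfM.
have ? : i.+1%:R != 0 :> R by rewrite pnatr_eq0.
have ? : i`!%:R != 0 :> R by rewrite pnatr_eq0 -lt0n fact_gt0.
by field; apply/andP.
Qed.

(** The sign makes the alternating remainder nonnegative on [y >= 0] and makes each remainder the
    derivative of the next, which drives the induction below. *)
Definition expN_remainder k (y : R) :=
  (-1) ^+ k * (expR (- y) - (expN_taylor k).[y]).

Lemma is_derive_expN_remainder k (y : R) :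
  is_derive y 1 (expN_remainder k.+1) (expN_remainder k y).
Proof.
have d1 := is_derive_poly (expN_taylor k.+1) y.
have d2 := @is_derive1_comp _ expR _ _ _ _ (is_derive_expR _) (is_deriveNid y 1).
have d3 := is_deriveB d2 d1.
have := is_deriveZ ((-1) ^+ k.+1) d3.
rewrite (_ : _ \*: _ = expN_remainder k.+1)//.
move/is_derive_eq; apply.
rewrite deriv_expN_taylor hornerN /expN_remainder /GRing.scale/= exprS; ring.
Qed.

Lemma expN_remainder_bound k (y : R) : 0 <= y ->
  0 <= expN_remainder k y <= y ^+ k / k`!%:R.
Proof.
elim: k y => [|k ih] y y0.
  rewrite /expN_remainder /expN_taylor expr0 mul1r horner_poly big_ord0 subr0.
  by rewrite expr0 fact0 invr1 mulr1 expR_ge0 -expR0 ler_expR oppr_le0.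
have r0 : expN_remainder k.+1 0 = 0.
  rewrite /expN_remainder horner_coef0 coef_poly /= oppr0 expR0 fact0.
  by rewrite expr0 divr1 subrr mulr0.
apply/andP; split.
  rewrite -r0; apply: (@derive_ge0_le _ (expN_remainder k)) => //.
    exact: is_derive_expN_remainder.
  by move=> x /ih/andP[].
pose p : {poly R} := (k.+1`!%:R)^-1 *: 'X^(k.+1).
pose f x := p.[x] - expN_remainder k.+1 x.
have := @derive_ge0_le f (fun x => x ^+ k / k`!%:R - expN_remainder k x) y.
rewrite /f r0 subr0 /p !hornerZ !hornerXn expr0n mulr0 subr_ge0 mulrC; apply => //.
- move=> x.
  have := is_deriveB (is_derive_poly p x) (is_derive_expN_remainder k x).
  rewrite (_ : horner p - _ = (fun y : R => p.[y] - expN_remainder k.+1 y))//.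
  rewrite /p; under eq_fun do rewrite hornerZ hornerXn mulrC.
  move/is_derive_eq; apply.
  rewrite derivZ derivXn hornerZ hornerMn hornerXn factS natrM; congr (_ - _).
  have ? : k`!%:R != 0 :> R by rewrite pnatr_eq0 -lt0n fact_gt0.
  have ? : k.+1%:R != 0 :> R by rewrite pnatr_eq0.
  by rewrite /= -mulr_natr; field; apply/andP.
- by move=> x /ih/andP[]; rewrite subr_ge0.
Qed.

(** The bound holds for all [y >= 0] and is a pure power of [y]: integrated over the unbounded
    perturbation it yields a moment again. *)
Lemma expRN_taylor_bound k (y : R) : 0 <= y ->
  `|expR (- y) - \sum_(j < k) (- y) ^+ j / j`!%:R| <= y ^+ k / k`!%:R.
Proof.
move=> /(expN_remainder_bound k)/andP[r0 r1].
rewrite (_ : _ - _ = (-1) ^+ k * expN_remainder k y).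
  by rewrite normrM normrX normrN1 expr1n mul1r ger0_norm.
rewrite /expN_remainder mulrA -expr2 sqrr_sign mul1r horner_poly.
by congr (_ - _); apply: eq_bigr => j _; rewrite [in LHS]exprNn mulrAC.
Qed.

(** Mean value theorem: summing the geometric series, the difference of [ln (1 + x)] and its Taylor
    polynomial has derivative [(- x) ^+ k / (1 + x)], and [1 + x >= 1/2]. *)
Lemma ln1p_taylor_bound k (w : R) : `|w| <= 2^-1 ->
  `|ln (1 + w) - \sum_(i < k) (-1) ^+ i * w ^+ i.+1 / i.+1%:R| <= 2 * `|w| ^+ k.+1.
Proof.
move=> w2.
pose p : {poly R} := \sum_(i < k) ((-1) ^+ i / i.+1%:R) *: 'X^(i.+1).
have pE x : p.[x] = \sum_(i < k) (-1) ^+ i * x ^+ i.+1 / i.+1%:R.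
  rewrite /p horner_sum; apply: eq_bigr => i _.
  by rewrite hornerZ hornerXn mulrAC.
have dpE x : 1 + x != 0 -> p^`().[x] = (1 - (- x) ^+ k) / (1 + x).
  move=> x1; apply: (mulIf x1); rewrite divfK//.
  rewrite /p raddf_sum/= horner_sum.
  rewrite (eq_bigr (fun i : 'I_k => (- x) ^+ i)); last first.
    move=> i _; rewrite derivZ derivXn hornerZ hornerMn hornerXn /=.
    by rewrite -[x ^+ i *+ _]mulr_natr mulrA mulrAC divfK ?pnatr_eq0// -exprMn mulN1r.
  have := subrX1 (- x) k; rewrite -[RHS]mulrC.
  by move=> e; rewrite -[1 - _]opprB e; ring.
pose h x := ln (1 + x) - p.[x].
have hD (x : R) : `|x| <= 2^-1 -> is_derive x 1 h ((- x) ^+ k / (1 + x)).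
  rewrite ler_norml => /andP[xl xr].
  have x0 : 0 < 1 + x by lra.
  have d1 := @is_derive1_comp _ (@ln R) (fun y => 1 + y) x _ 1 (is_derive1_ln x0).
  have d0 : is_derive x 1 (fun y : R => 1 + y) 1.
    have := is_deriveD (is_derive_cst (1 : R) x 1) (is_derive_id x (1 : R)).
    by rewrite add0r.
  have := is_deriveB (d1 d0) (is_derive_poly p x).
  rewrite (_ : _ - _ = h)//; move/is_derive_eq; apply.
  rewrite dpE ?gt_eqF//; have ? : 1 + x != 0 by rewrite gt_eqF.
  by field.
have key (x : R) : `|x| <= `|w| -> `|(- x) ^+ k / (1 + x)| <= 2 * `|w| ^+ k.
  move=> xw; have : `|x| <= 2^-1 by exact: le_trans w2.
  rewrite ler_norml => /andP[xl xr]; have x0 : 0 < 1 + x by lra.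
  rewrite normrM normrX normrN normfV (gtr0_norm x0) ler_pdivrMr//.
  have h1 : `|x| ^+ k <= `|w| ^+ k by rewrite lerXn2r ?nnegrE.
  have h2 : 0 <= `|w| ^+ k by rewrite exprn_ge0.
  by move: (`|x| ^+ k) (`|w| ^+ k) h1 h2 => u v; nra.
have h0 : h 0 = 0.
  rewrite /h addr0 ln1 pE big1 ?subrr// => i _.
  by rewrite expr0n/= mulr0 mul0r.
have ch (x : R) : `|x| <= 2^-1 -> {for x, continuous h}.
  move=> /hD dh; apply: differentiable_continuous; apply/derivable1_diffP.
  by case: dh.
rewrite -pE -/(h w) -[h w]subr0 -h0 exprS mulrCA.
have [w0|w0|->] := ltgtP w 0; last by rewrite subrr normr0 mul0r.
- have [||x] := @MVT R h (fun x => (- x) ^+ k / (1 + x)) w 0 w0.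
  + move=> x; rewrite in_itv/= => /andP[xl xr]; apply: hD.
    by apply: le_trans w2; rewrite !ltr0_norm ?lerN2 ?ltW.
  + apply: continuous_in_subspaceT => x; rewrite inE/= in_itv/= => /andP[xl xr].
    by apply: ch; apply: le_trans w2; rewrite !ler0_norm ?lerN2// ltW.
  rewrite in_itv/= => /andP[xl xr] e.
  rewrite distrC e sub0r normrM normrN mulrC ler_wpM2l//.
  by apply: key; rewrite !ltr0_norm ?lerN2 ?ltW.
- have [||x] := @MVT R h (fun x => (- x) ^+ k / (1 + x)) 0 w w0.
  + move=> x; rewrite in_itv/= => /andP[xl xr]; apply: hD.
    by apply: le_trans w2; rewrite !gtr0_norm ?ltW.
  + apply: continuous_in_subspaceT => x; rewrite inE/= in_itv/= => /andP[xl xr].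
    by apply: ch; apply: le_trans w2; rewrite !ger0_norm// ltW.
  rewrite in_itv/= => /andP[xl xr] e.
  rewrite e subr0 normrM mulrC ler_wpM2l//.
  by apply: key; rewrite !gtr0_norm ?ltW.
Qed.

Lemma exprB_bound (w v : R) i : `|w| <= 1 -> `|v| <= 1 ->
  `|w ^+ i - v ^+ i| <= i%:R * `|w - v|.
Proof.
move=> w1 v1; elim: i => [|i ih]; first by rewrite subrr normr0 mul0r.
rewrite !exprS (_ : _ - _ = w * (w ^+ i - v ^+ i) + (w - v) * v ^+ i); last by ring.
rewrite (le_trans (ler_normD _ _))// -natr1 [leRHS]mulrDl mul1r lerD//.
  by rewrite normrM (le_trans _ ih)// ler_piMl.
by rewrite normrM ler_piMr// normrX exprn_ile1.
Qed.

(** The logarithm is taken at the exact value [w], its polynomial at the approximation [v]. The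
    factor [i + 1] from comparing powers cancels the denominator, leaving [e] per term. *)
Lemma ln1p_taylor_perturbation k (w v e : R) : `|w| <= 2^-1 -> `|v| <= 2^-1 ->
  `|w - v| <= e ->
  `|ln (1 + w) - \sum_(i < k) (-1) ^+ i * v ^+ i.+1 / i.+1%:R|
    <= 2 * `|w| ^+ k.+1 + k%:R * e.
Proof.
move=> w2 v2 wv.
rewrite (_ : _ - _ = (ln (1 + w) - \sum_(i < k) (-1) ^+ i * w ^+ i.+1 / i.+1%:R)
  + \sum_(i < k) (-1) ^+ i * (w ^+ i.+1 - v ^+ i.+1) / i.+1%:R); last first.
  rewrite -[RHS]addrA; congr (_ + _); rewrite -!sumrN -big_split.
  by apply: eq_bigr => i _ /=; ring.
rewrite (le_trans (ler_normD _ _))// lerD ?ln1p_taylor_bound//.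
rewrite (le_trans (ler_norm_sum _ _ _))//.
rewrite (le_trans (ler_sum _ (_ : forall i : 'I_k, true -> _ <= e)))//; last first.
  by rewrite sumr_const card_ord mulr_natl.
move=> i _; rewrite !normrM normrX normrN1 expr1n mul1r normfV normr_nat.
rewrite ler_pdivrMr ?ltr0n// mulrC (le_trans (exprB_bound _ _ _))//.
- by rewrite (le_trans w2)// invf_le1// ler1n.
- by rewrite (le_trans v2)// invf_le1// ler1n.
- by rewrite ler_wpM2l.
Qed.

End taylor_estimates.

(** * Expansion of the partition function *)

Section laplace_expansion.
Context {R : realType} (nu : nat).
Hypothesis nu_gt0 : (0 < nu)%N.
Local Notation T := (measurableTypeR R).

Definition perturbation n (z : n.-tuple T) : R :=
  (\sum_(i < n) tnth z i ^+ (2 * nu)) / (2 * nu)%:R.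

Lemma perturbation_ge0 n (z : n.-tuple T) : 0 <= perturbation z.
Proof.
rewrite divr_ge0// sumr_ge0// => i _; rewrite exprM exprn_ge0//.
exact: sqr_ge0.
Qed.

Lemma partition_functionE n N (u : R) : partition_function nu n N u =
  \int[lebesgue_tuple R n]_z (squared_vandermonde (tnth z) *
    gaussian_weight N%:R z * expR (- (N%:R * u * perturbation z))).
Proof.
apply: eq_Rintegral => z _; rewrite -mulrA; congr (_ * _).
rewrite /perturbation mulr_suml mulr_sumr -sumrN expR_sum -big_split/=.
apply: eq_bigr => j _; rewrite -expRD; congr expR.
by rewrite /potential; ring.
Qed.

Lemma measurable_perturbation n : measurable_fun setT (@perturbation n).
Proof.
apply: measurable_funM; last exact: measurable_cst.
apply: measurable_sum => i; apply: measurable_funX; exact: measurable_tnth.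
Qed.

(** The [j]-th power of the perturbation involves [j] copies of the power sum of index [2 nu]; their
    total degree [2 nu j] accounts for the factor [N ^ (nu j)]. *)
Lemma gaussian_moments_perturbation : exists m : nat -> {poly R},
  (forall n, (m 0).[n%:R] = 1) /\
  forall n N, (0 < N)%N ->
    [/\ 0 < partition_function nu n N (0 : R),
      (lebesgue_tuple R n).-integrable setT (EFin \o (fun z =>
        squared_vandermonde (tnth z) * gaussian_weight N%:R z)) &
      forall j, (lebesgue_tuple R n).-integrable setT (EFin \o (fun z =>
        perturbation z ^+ j *
          (squared_vandermonde (tnth z) * gaussian_weight N%:R z))) /\
      N%:R ^+ (nu * j) * \int[lebesgue_tuple R n]_z (perturbation z ^+ j *
          (squared_vandermonde (tnth z) * gaussian_weight N%:R z)) =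
      (m j).[n%:R] * partition_function nu n N 0].
Proof.
have [P hP] := choice (fun j =>
  LoopEquations.vandermonde2_moment_polynomial R (nseq j (2 * nu))).
have main n N : (0 < N)%N ->
    [/\ 0 < partition_function nu n N (0 : R),
      (lebesgue_tuple R n).-integrable setT (EFin \o (fun z =>
        squared_vandermonde (tnth z) * gaussian_weight N%:R z)) &
      forall j, (lebesgue_tuple R n).-integrable setT (EFin \o (fun z =>
        perturbation z ^+ j *
          (squared_vandermonde (tnth z) * gaussian_weight N%:R z))) /\
      N%:R ^+ (nu * j) * \int[lebesgue_tuple R n]_z (perturbation z ^+ j *
          (squared_vandermonde (tnth z) * gaussian_weight N%:R z)) =
      ((2 * nu)%:R ^- j *: P j).[n%:R] * partition_function nu n N 0].
  move=> N0; have a0 : 0 < N%:R :> R by rewrite ltr0n.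
  have Z0E : partition_function nu n N (0 : R) = \int[lebesgue_tuple R n]_z
      (squared_vandermonde (tnth z) * gaussian_weight N%:R z).
    rewrite partition_functionE; apply: eq_Rintegral => z _.
    by rewrite mulr0 mul0r oppr0 expR0 mulr1.
  have hj j : (lebesgue_tuple R n).-integrable setT (EFin \o (fun z =>
        squared_vandermonde (tnth z) * gaussian_weight N%:R z)) /\
      0 < partition_function nu n N (0 : R) /\
      (lebesgue_tuple R n).-integrable setT (EFin \o (fun z =>
        perturbation z ^+ j *
          (squared_vandermonde (tnth z) * gaussian_weight N%:R z))) /\
      N%:R ^+ (nu * j) * \int[lebesgue_tuple R n]_z (perturbation z ^+ j *
          (squared_vandermonde (tnth z) * gaussian_weight N%:R z)) =
      ((2 * nu)%:R ^- j *: P j).[n%:R] * partition_function nu n N 0.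
    have [M0 [M [hM0 hM eM]]] := hP j n N%:R (gaussian_moment N%:R)
      (gaussian_moment1 a0) (fun k => gaussian_momentSS k a0).
    have M0_gt0 := gaussian_vandermonde_gt0 a0 hM0.
    have [i0 e0] := has_moment_integral a0 hM0.
    have [i1 e1] := has_moment_integral a0 hM.
    have Z0M0 : partition_function nu n N (0 : R) = M0 by rewrite Z0E -e0.
    have pE : (fun z : n.-tuple T => perturbation z ^+ j *
          (squared_vandermonde (tnth z) * gaussian_weight N%:R z)) =
        (fun z => (2 * nu)%:R ^- j * ((\prod_(m <- nseq j (2 * nu)%N)
           \sum_(i < n) tnth z i ^+ m) * squared_vandermonde (tnth z) *
           gaussian_weight N%:R z)).
      apply/funext => z; rewrite big_nseq -Monoid.iteropE -/(GRing.exp _ _).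
      by rewrite /perturbation exprMn exprVn; ring.
    split; first exact: i0.
    split; first by rewrite Z0M0.
    rewrite pE; split; first exact: integrableZ_EFin.
    rewrite RintegralZl// e1 hornerZ Z0M0 -!mulrA -eM mulrCA; congr (_ * (_ ^+ _ * _)).
    by rewrite sumn_nseq; lia.
  have [i0 [p0 _]] := hj 0%N.
  split; [exact: p0|exact: i0|move=> j].
  by have [_ [_ ?]] := hj j.
exists (fun j => (2 * nu)%:R ^- j *: P j); split => [n|]; last exact: main.
(* As [m 0] is independent of [N], its value can be read off at [N = 1]. *)
have [Z0 _ /(_ 0%N)[_]] := main n 1%N isT.
have -> : \int[lebesgue_tuple R n]_z (perturbation z ^+ 0 *
    (squared_vandermonde (tnth z) * gaussian_weight 1 z)) =
    partition_function nu n 1 0.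
  rewrite partition_functionE; apply: eq_Rintegral => z _.
  by rewrite mulr0 mul0r oppr0 expR0 mulr1 expr0 mul1r.
by rewrite expr1n mul1r -{1}[partition_function _ _ _ _]mul1r => /mulIf <-//; rewrite gt_eqF.
Qed.

(** The pointwise Taylor bound for [exp (-y)] is integrated against the Gaussian ensemble, and its
    right side is the next moment. Powers of [N] and [u] combine into [t] because
    [(N u)^j N^(- nu j) = t^j]. *)
Lemma laplace_expansion : exists m : nat -> {poly R},
  (forall n, (m 0).[n%:R] = 1) /\
  forall k n N (u t : R), (0 < N)%N -> 0 <= u -> t = u / N%:R ^+ nu.-1 ->
    `|partition_function nu n N u / partition_function nu n N 0 -
      \sum_(j < k) (- t) ^+ j / j`!%:R * (m j).[n%:R]|
    <= t ^+ k / k`!%:R * (m k).[n%:R].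
Proof.
have [m [m0 hm]] := gaussian_moments_perturbation; exists m; split => //.
move=> k n N u t N0 u0 tE.
have [Z0 i0 hj] := hm n N N0.
have a0 : 0 < N%:R :> R by rewrite ltr0n.
pose L := lebesgue_tuple R n.
pose y (z : n.-tuple T) := N%:R * u * perturbation z.
pose w (z : n.-tuple T) := squared_vandermonde (tnth z) * gaussian_weight N%:R z.
have w0 z : 0 <= w z.
  by rewrite mulr_ge0 ?squared_vandermonde_ge0 ?gaussian_weight_ge0.
have y0 z : 0 <= y z by exact: (mulr_ge0 (mulr_ge0 (ltW a0) u0) (perturbation_ge0 z)).
have yj j : L.-integrable setT (EFin \o (fun z => y z ^+ j * w z)) /\
    \int[L]_z (y z ^+ j * w z) = t ^+ j * (m j).[n%:R] * partition_function nu n N 0.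
  have [ij ej] := hj j.
  have -> : (fun z => y z ^+ j * w z) =
      (fun z => (N%:R * u) ^+ j * (perturbation z ^+ j * w z)).
    by apply/funext => z; rewrite /y exprMn mulrA.
  split; first exact: integrableZ_EFin.
  rewrite RintegralZl// -[RHS]mulrA -ej mulrA; congr (_ * _).
  rewrite tE !exprMn exprVn -exprM.
  have -> : (nu * j = nu.-1 * j + j)%N by rewrite -{1}(prednK nu_gt0) mulSn addnC.
  rewrite exprD.
  have Ne : N%:R ^+ (nu.-1 * j) != 0 :> R by rewrite expf_neq0// gt_eqF.
  by field.
have my : measurable_fun setT y.
  by apply: measurable_funM; [exact: measurable_cst|exact: measurable_perturbation].
have ie : L.-integrable setT (EFin \o (fun z => w z * expR (- y z))).
  apply: (le_integrable _ _ _ i0) => //.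
    apply/measurable_EFinP; apply: measurable_funM.
      by have /integrableP[/measurable_EFinP] := i0.
    apply: (measurableT_comp (@measurable_expR R)).
    exact: (measurableT_comp (@oppr_measurable R _)).
  move=> z _ /=; rewrite lee_fin normrM ler_piMr//.
  by rewrite ger0_norm ?expR_ge0// expR_le1 oppr_le0.
have [isum es] := Rintegral_lincomb (index_enum 'I_k)
  (fun j : 'I_k => (-1) ^+ j / j`!%:R) (fun j : 'I_k => (yj j).1).
have [ik ek] := yj k.
have key : `|partition_function nu n N u - \sum_(j < k) (-1) ^+ j / j`!%:R *
      \int[L]_z (y z ^+ j * w z)| <= (k`!%:R)^-1 * \int[L]_z (y z ^+ k * w z).
  rewrite partition_functionE -es -RintegralB//.
  apply: (le_trans (le_normr_Rintegral _ _)) => //.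
    exact: (integrableB measurableT ie isum).
  rewrite -RintegralZl//; apply: le_Rintegral => //.
  - apply: integrable_norm; exact: (integrableB measurableT ie isum).
  - exact: integrableZ_EFin.
  move=> z _.
  rewrite (_ : _ - _ = w z * (expR (- y z) - \sum_(j < k) (- y z) ^+ j / j`!%:R)).
    rewrite normrM (ger0_norm (w0 z)) mulrA [leRHS]mulrC ler_wpM2l//.
    by rewrite mulrC; exact: expRN_taylor_bound.
  rewrite mulrBr mulr_sumr; congr (_ - _); apply: eq_bigr => j _.
  by rewrite [(- y z) ^+ _]exprNn; ring.
have ZE : partition_function nu n N 0 != 0 :> R by rewrite gt_eqF.
rewrite -(ler_pM2r Z0) -[X in _ * X <= _](gtr0_norm Z0) -normrM mulrBl divfK//.
rewrite mulr_suml.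
rewrite (_ : \sum_(j < k) _ = \sum_(j < k) (-1) ^+ j / j`!%:R *
      \int[L]_z (y z ^+ j * w z)).
  by apply: (le_trans key); rewrite ek; lra.
apply: eq_bigr => j _; have [_ ->] := yj j.
by rewrite [(- t) ^+ _]exprNn; ring.
Qed.

End laplace_expansion.

(** * Expansion of the logarithm *)

Section log_expansion.
Context {R : realType}.

Lemma poly_family_bound (p : nat -> {poly R}) K : exists C B, 1 <= C /\
  forall j n, (j < K)%N -> (0 < n)%N -> `|(p j).[n%:R]| <= C * n%:R ^+ B.
Proof.
elim: K => [|K [C [B [C1 ih]]]]; first by exists 1, 0%N.
exists (C + \sum_(i < size (p K)) `|(p K)`_i|), (B + size (p K))%N.
have S0 : 0 <= \sum_(i < size (p K)) `|(p K)`_i| by apply: sumr_ge0.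
have C0 : 0 <= C by rewrite (le_trans ler01).
split; first by rewrite (le_trans C1)// lerDl.
move=> j n jK n0.
have n1 : 1 <= n%:R :> R by rewrite ler1n.
have mono a b : (a <= b)%N -> n%:R ^+ a <= n%:R ^+ b :> R.
  by move=> ab; rewrite ler_weXn2l.
have [jK'|Kj] := ltnP j K.
  rewrite (le_trans (ih _ _ jK' n0))//.
  apply: ler_pM; rewrite ?exprn_ge0 ?ler0n//; first by rewrite lerDl.
  by apply: mono; rewrite leq_addr.
have -> : j = K by lia.
rewrite horner_coef (le_trans (ler_norm_sum _ _ _))//.
rewrite (@le_trans _ _ ((\sum_(i < size (p K)) `|(p K)`_i|) *
  n%:R ^+ (B + size (p K))))//; last first.
  by rewrite ler_wpM2r ?exprn_ge0 ?ler0n// lerDr.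
rewrite mulr_suml; apply: ler_sum => i _.
rewrite normrM normrX normr_nat ler_wpM2l// mono//.
by rewrite (leq_trans (ltnW (ltn_ord i)))// leq_addl.
Qed.

Lemma log_expansion (m : nat -> {poly R}) (m0 : forall n, (m 0).[n%:R] = 1) k :
  exists (P : nat -> {poly R}) C B, 1 <= C /\
  forall n (t X : R), (0 < n)%N -> 0 <= t -> C * n%:R ^+ B * t <= 1 ->
    `|X - \sum_(j < k.+1) (- t) ^+ j / j`!%:R * (m j).[n%:R]|
      <= t ^+ k.+1 / k.+1`!%:R * (m k.+1).[n%:R] ->
    `|ln X - \sum_(j < k.+1) (P j).[n%:R] * t ^+ j| <= C * n%:R ^+ B * t ^+ k.+1.
Proof.
have [C1 [B1 [C1_ge1 hC1]]] := poly_family_bound m k.+2.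
(* Outer variable [t], inner variable [n]: [W] is the truncated expansion of [X - 1], and [S] below
   is the truncated logarithm series evaluated at it. *)
pose W : {poly {poly R}} := \sum_(j < k)
  (((-1) ^+ j.+1 / j.+1`!%:R) *: m j.+1) *: 'X^(j.+1).
pose S : {poly {poly R}} := \sum_(i < k) ((-1) ^+ i / i.+1%:R)%:P *: W ^+ i.+1.
have [C2 [B2 [C2_ge1 hC2]]] := poly_family_bound (fun j => S`_j) (k.+1 + size S).
pose V n t := \sum_(j < k) (- t) ^+ j.+1 / j.+1`!%:R * (m j.+1).[n%:R].
have WE n t : W.[t%:P].[n%:R] = V n t.
  rewrite /W !horner_sum; apply: eq_bigr => j _.
  rewrite !hornerZ hornerXn hornerM hornerZ horner_exp hornerC [(- t) ^+ _]exprNn.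
  by ring.
have SE n t : S.[t%:P].[n%:R] = \sum_(i < k) (-1) ^+ i * V n t ^+ i.+1 / i.+1%:R.
  rewrite /S !horner_sum; apply: eq_bigr => i _.
  by rewrite hornerZ hornerM horner_exp horner_exp WE hornerC mulrAC.
have SE2 n t : S.[t%:P].[n%:R] = \sum_(j < k.+1 + size S) (S`_j).[n%:R] * t ^+ j.
  rewrite (@horner_coef_wide _ (k.+1 + size S) S) ?leq_addl// horner_sum.
  by apply: eq_bigr => j _; rewrite hornerM horner_exp hornerC.
pose K : R := k.+1%:R.
have K1 : 1 <= K by rewrite ler1n.
have C1_ge0 : 0 <= C1 by rewrite (le_trans ler01).
have C2_ge0 : 0 <= C2 by rewrite (le_trans ler01).
(* The first summand of the constant forces [|X - 1| <= 1/2]; the others pay for the remainder of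
   the logarithm, the replacement of [X - 1] by [V n t], and the powers of [t] above [k] in [S]. The
   exponent dominates those of all these terms. *)
exists (fun j => S`_j), (2 * K * C1 + 2 * (K * C1) ^+ k.+1 + K * C1 + (size S)%:R * C2),
  (B1 * k.+1 + B2)%N.
have D0 : 0 <= 2 * (K * C1) ^+ k.+1.
  by rewrite mulr_ge0// exprn_ge0// mulr_ge0// (le_trans ler01).
have D1 : 0 <= (size S)%:R * C2 by rewrite mulr_ge0.
have D2 : 0 <= K * C1 by rewrite mulr_ge0.
have D3 : C1 <= K * C1 by rewrite ler_peMl.
split; first by lra.
move=> n t X n0 t0 hCt hX.
have n1 : 1 <= n%:R :> R by rewrite ler1n.
have mono a b : (a <= b)%N -> n%:R ^+ a <= n%:R ^+ b :> R.
  by move=> ab; rewrite ler_weXn2l.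
have ge1 a : 1 <= n%:R ^+ a :> R by rewrite exprn_ege1.
set B := (B1 * k.+1 + B2)%N in hCt *.
set C := (2 * K * C1 + _ + _ + _) in hCt *.
have nB1 : n%:R ^+ B1 <= n%:R ^+ B :> R by apply: mono; rewrite /B mulnS -addnA leq_addr.
pose y := C1 * n%:R ^+ B1 * t.
have ty : t <= y by rewrite /y ler_peMl// mulr_ege1.
have Ky : 2 * K * y <= 1.
  apply: le_trans hCt; rewrite /y !mulrA ler_wpM2r//.
  apply: ler_pM; rewrite ?exprn_ge0 ?mulr_ge0 ?ler0n//.
  by rewrite /C; lra.
have y0 : 0 <= y by exact: le_trans ty.
have yKy : y <= K * y by rewrite ler_peMl.
have t1 : t <= 1 by lra.
have tj j : t ^+ j.+1 <= t by rewrite exprS ler_piMr// exprn_ile1.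
have fact1 j : (j`!%:R)^-1 <= 1 :> R by rewrite invf_le1 ?ltr0n ?fact_gt0// ler1n fact_gt0.
have termb j : (0 < j <= k.+1)%N ->
    t ^+ j / j`!%:R * `|(m j).[n%:R]| <= t ^+ j * (C1 * n%:R ^+ B1).
  move=> /andP[j0 jk].
  apply: ler_pM; rewrite ?mulr_ge0 ?exprn_ge0 ?invr_ge0 ?ler0n//.
    by rewrite ler_piMr ?exprn_ge0.
  exact: hC1.
have Vb : `|V n t| <= k%:R * y.
  rewrite /V (le_trans (ler_norm_sum _ _ _))//.
  rewrite (le_trans (ler_sum _ (_ : forall i : 'I_k, true -> _ <= y)))//; last first.
    by rewrite sumr_const card_ord mulr_natl.
  move=> j _; rewrite !normrM normfV normrX normrN normr_nat (ger0_norm t0).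
  apply: le_trans (termb j.+1 _) _; first by apply/andP; split => //; exact: leqW (ltn_ord j).
  by rewrite /y mulrC ler_wpM2l ?mulr_ge0 ?exprn_ge0 ?ler0n.
pose e := C1 * n%:R ^+ B1 * t ^+ k.+1.
have wv : `|(X - 1) - V n t| <= e.
  rewrite (_ : X - 1 - V n t = X - \sum_(j < k.+1) (- t) ^+ j / j`!%:R * (m j).[n%:R]).
    apply: le_trans hX _; rewrite /e [leRHS]mulrC.
    apply: le_trans (termb _ _); last by rewrite ltnSn.
    by rewrite ler_wpM2l ?ler_norm// mulr_ge0 ?exprn_ge0 ?invr_ge0 ?ler0n.
  by rewrite big_ord_recl expr0 fact0 divr1 mul1r m0 opprD addrA.
have ey : e <= y by rewrite /e /y ler_wpM2l ?mulr_ge0 ?exprn_ge0 ?ler0n.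
have KE : K = k%:R + 1 by rewrite /K natr1.
have k0 : 0 <= k%:R :> R by [].
have wb : `|X - 1| <= K * y.
  have := ler_normD ((X - 1) - V n t) (V n t); rewrite subrK => h.
  by rewrite KE mulrDl mul1r; lra.
have w2 : `|X - 1| <= 2^-1 by lra.
have v2 : `|V n t| <= 2^-1.
  have : k%:R * y <= K * y by rewrite ler_wpM2r// KE lerDl.
  by lra.
have := ln1p_taylor_perturbation k w2 v2 wv; rewrite -SE (addrC 1) subrK => hln.
have tailb : `|\sum_(j < size S) (S`_(k.+1 + j)).[n%:R] * t ^+ (k.+1 + j)| <=
    (size S)%:R * C2 * n%:R ^+ B2 * t ^+ k.+1.
  rewrite (le_trans (ler_norm_sum _ _ _))//.
  rewrite (le_trans (ler_sum _ (_ : forall i : 'I_(size S), true ->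
    _ <= C2 * n%:R ^+ B2 * t ^+ k.+1)))//; last first.
    by rewrite sumr_const card_ord -!mulrA mulr_natl.
  move=> j _; rewrite normrM normrX (ger0_norm t0).
  apply: ler_pM; rewrite ?exprn_ge0//; first by apply: hC2; rewrite ?ltn_add2l.
  by rewrite exprD ler_piMr ?exprn_ge0// exprn_ile1.
rewrite (_ : _ - _ = (ln X - S.[t%:P].[n%:R]) +
  \sum_(j < size S) (S`_(k.+1 + j)).[n%:R] * t ^+ (k.+1 + j)); last first.
  by rewrite SE2 big_split_ord/=; ring.
apply: le_trans (ler_normD _ _) _.
apply: le_trans (lerD hln tailb) _.
have wbk : 2 * `|X - 1| ^+ k.+1 <= 2 * (K * C1) ^+ k.+1 * n%:R ^+ B * t ^+ k.+1.
  rewrite -!mulrA ler_wpM2l//.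
  apply: (@le_trans _ _ ((K * y) ^+ k.+1)); first by rewrite lerXn2r ?nnegrE// (le_trans _ wb).
  rewrite /y !mulrA !exprMn ler_wpM2r ?exprn_ge0//.
  rewrite ler_wpM2l ?mulr_ge0 ?exprn_ge0//.
  by rewrite -exprM mono// /B leq_addr.
have eb : k%:R * e <= K * C1 * n%:R ^+ B * t ^+ k.+1.
  rewrite /e !mulrA ler_wpM2r ?exprn_ge0//.
  apply: ler_pM => //; rewrite ?mulr_ge0 ?exprn_ge0 ?ler0n//.
  by rewrite ler_wpM2r// KE lerDl.
have tb : (size S)%:R * C2 * n%:R ^+ B2 * t ^+ k.+1 <=
    (size S)%:R * C2 * n%:R ^+ B * t ^+ k.+1.
  by rewrite ler_wpM2r ?exprn_ge0// ler_wpM2l// mono// /B leq_addl.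
apply: le_trans (lerD (lerD wbk eb) tb) _.
rewrite -!mulrDl ler_wpM2r ?exprn_ge0// ler_wpM2r ?exprn_ge0 ?ler0n//.
by rewrite /C !lerD2r lerDr mulr_ge0// mulr_ge0.
Qed.

End log_expansion.

(** * Power series *)

Section power_series.
Context {R : realType}.
Implicit Types (a b : nat -> R) (h : R -> R) (r : R).

Definition power_series_sum a h r := forall y : R, `|y| < r ->
  series (fun k => a k * y ^+ k) @ \oo --> h y.

(** Terms are bounded at a point [s] inside the disc; for [|y| <= s / 2] the tail is dominated by a
    geometric series of ratio at most 1/2, whose sum is at most 2. *)
Lemma power_series_tail a h r J : 0 < r -> power_series_sum a h r ->
  exists C r', [/\ 0 <= C, 0 < r' & forall y, `|y| <= r' ->
    `|h y - \sum_(k < J) a k * y ^+ k| <= C * `|y| ^+ J].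
Proof.
move=> r0 ah; have [s s0 sr'] : exists2 s : R, 0 < s & s < r by exists (r / 2); lra.
have sr : `|s| < r by rewrite gtr0_norm.
have /cvg_series_cvg_0 t0 : cvgn (series (fun k => a k * s ^+ k)).
  by apply/cvg_ex; exists (h s); exact: ah.
have [M [M0 hM]] : exists M, 0 <= M /\ forall k, `|a k * s ^+ k| <= M.
  have /cvg_seq_bounded [M [Mr hM]] : cvgn (fun k => a k * s ^+ k).
    by apply/cvg_ex; exists 0.
  have hM' k : `|a k * s ^+ k| <= `|M| + 1.
    by apply: (hM (`|M| + 1)) => //; rewrite (le_lt_trans (ler_norm M))// ltrDl.
  by exists (`|M| + 1); split => //; rewrite addr_ge0.
have geom (q : R) n : 0 <= q <= 2^-1 -> \sum_(i < n) q ^+ i <= 2.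
  move=> /andP[q0 q2]; elim: n => [|n ih]; first by rewrite big_ord0.
  rewrite big_ord_recl expr0.
  have -> : \sum_(i < n) q ^+ lift ord0 i = q * \sum_(i < n) q ^+ i.
    by rewrite mulr_sumr; apply: eq_bigr => i _; rewrite -exprS.
  have : 0 <= \sum_(i < n) q ^+ i.
    by apply: sumr_ge0 => i _; rewrite exprn_ge0.
  by nra.
exists (2 * M / s ^+ J), (s / 2); split.
- by rewrite divr_ge0 ?exprn_ge0 ?mulr_ge0// ltW.
- by rewrite divr_gt0.
move=> y ys.
have yr : `|y| < r by rewrite (le_lt_trans ys)//; lra.
pose q := `|y| / s.
have q0 : 0 <= q by rewrite divr_ge0// ltW.
have q2 : q <= 2^-1 by rewrite /q ler_pdivrMr// mulrC.
have termb k : `|a k * y ^+ k| <= M * q ^+ k.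
  have -> : `|a k * y ^+ k| = `|a k * s ^+ k| * q ^+ k.
    rewrite normrM [X in _ = X * _]normrM -mulrA; congr (_ * _).
    rewrite (ger0_norm (exprn_ge0 k (ltW s0))) normrX /q expr_div_n.
    by rewrite mulrC divfK// expf_neq0// gt_eqF.
  by rewrite ler_wpM2r ?exprn_ge0.
have tailb n : `|series (fun k => a k * y ^+ k) (J + n)%N -
    \sum_(k < J) a k * y ^+ k| <= 2 * M / s ^+ J * `|y| ^+ J.
  rewrite /series /= big_mkord big_split_ord/= [X in `|X|]addrC addKr.
  rewrite (le_trans (ler_norm_sum _ _ _))//.
  rewrite (le_trans (ler_sum _ (fun (i : 'I_n) _ => termb (J + i)%N)))//.
  under eq_bigr do rewrite exprD mulrA.
  rewrite -mulr_sumr (_ : 2 * M / s ^+ J * `|y| ^+ J = M * q ^+ J * 2); last first.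
    by rewrite /q expr_div_n; ring.
  by rewrite ler_wpM2l ?geom ?q0// mulr_ge0 ?exprn_ge0.
have lim1 : `|series (fun k => a k * y ^+ k) n - \sum_(k < J) a k * y ^+ k|
    @[n --> \oo] --> `|h y - \sum_(k < J) a k * y ^+ k|.
  by apply: cvg_norm; apply: cvgB; [exact: ah|exact: cvg_cst].
rewrite -(cvg_lim (@norm_hausdorff _ R) lim1).
apply: limr_le; first by apply/cvg_ex; eexists; exact: lim1.
near=> n; have Jn : (J <= n)%N by near: n; exact: nbhs_infty_ge.
by rewrite -(subnKC Jn).
Unshelve. all: by end_near. Qed.

(** If [a k] were the first nonzero coefficient, a zero [y] would give [|a k| <= C |y|] by the tail
    bound, impossible once [|y| < |a k| / (C + 1)]. *)
Lemma power_series_accumulating_zeros a h r : 0 < r -> power_series_sum a h r ->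
  (forall e : R, 0 < e -> exists y : R, 0 < `|y| < e /\ h y = 0) -> forall k, a k = 0.
Proof.
move=> r0 ah hz; elim/ltn_ind => k ih.
have [C [r' [C0 r'0 hC]]] := power_series_tail k.+1 r0 ah.
apply/eqP; apply: contraT => ak0.
have e0 : 0 < Num.min r' (`|a k| / (C + 1)).
  by rewrite lt_min r'0 divr_gt0 ?normr_gt0// ltr_pwDr.
have [y [/andP[y0 ye] hy]] := hz _ e0.
move: ye; rewrite lt_min => /andP[yr' ya].
have := hC y (ltW yr'); rewrite hy sub0r normrN big_ord_recr/= big1 ?add0r; last first.
  by move=> i _; rewrite ih// mul0r.
rewrite normrM normrX exprS mulrA ler_pM2r ?exprn_gt0// => aC.
move: ya; rewrite ltr_pdivlMr ?ltr_pwDr//; move: aC y0; move: (`|a k|) (`|y|) => u v.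
by rewrite mulrDr mulr1 => ? ? ?; exfalso; lra.
Qed.

Lemma power_series_accumulating_zeros_eq0 a h r : 0 < r ->
  power_series_sum a h r ->
  (forall e : R, 0 < e -> exists y : R, 0 < `|y| < e /\ h y = 0) ->
  forall y, `|y| < r -> h y = 0.
Proof.
move=> r0 ah hz y yr.
have a0 := power_series_accumulating_zeros r0 ah hz.
have := ah y yr; rewrite (_ : series _ = cst 0); last first.
  by apply/funext => n; rewrite /series /= big1// => k _; rewrite a0 mul0r.
by move=> /(cvg_unique (@norm_hausdorff _ R) (cvg_cst 0)) <-.
Qed.

Lemma power_seriesB a b h1 h2 r : power_series_sum a h1 r ->
  power_series_sum b h2 r ->
  power_series_sum (fun k => a k - b k) (fun y => h1 y - h2 y) r.
Proof.
move=> ah bh y yr.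
rewrite (_ : series _ = fun n => series (fun k => a k * y ^+ k) n -
  series (fun k => b k * y ^+ k) n); last first.
  apply/funext => n; rewrite /series /= -sumrB.
  by apply: eq_bigr => k _; rewrite mulrBl.
by apply: cvgB; [exact: ah|exact: bh].
Qed.

Lemma power_series_unique a b h r : 0 < r -> power_series_sum a h r ->
  power_series_sum b h r -> forall k, a k = b k.
Proof.
move=> r0 ah bh k; apply/eqP; rewrite -subr_eq0; apply/eqP.
apply: (power_series_accumulating_zeros r0 (power_seriesB ah bh)).
move=> e e0; exists (e / 2); split; last by rewrite subrr.
by rewrite gtr0_norm ?divr_gt0//; lra.
Qed.

Lemma power_series_cst c r :
  power_series_sum (fun k => if k is 0%N then c else 0) (fun=> c) r.
Proof.
move=> y _; rewrite -cvg_shiftS /=.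
rewrite (_ : (fun n => _) = cst c); first exact: cvg_cst.
apply/funext => n; rewrite /series /= big_nat_recl// big1 ?addr0 ?expr0 ?mulr1//.
by move=> k _; rewrite mul0r.
Qed.

Lemma power_series_mul1D a h r : power_series_sum a h r ->
  power_series_sum (fun k => a k + (if k is k'.+1 then a k' else 0))
    (fun y => (1 + y) * h y) r.
Proof.
move=> ah y yr; rewrite -cvg_shiftS /=.
rewrite (_ : (fun n => _) = fun n => series (fun k => a k * y ^+ k) n.+1 +
  y * series (fun k => a k * y ^+ k) n); last first.
  apply/funext => n; rewrite /series /=.
  under eq_bigr do rewrite mulrDl.
  rewrite big_split/=; congr (_ + _).
  rewrite big_nat_recl// mul0r add0r mulr_sumr.
  by apply: eq_bigr => k _; rewrite exprS mulrCA.
rewrite mulrDl mul1r; apply: cvgD.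
  by have := ah y yr; rewrite -cvg_shiftS.
by apply: cvgM; [exact: cvg_cst|exact: ah].
Qed.

Lemma power_series_mul1DX a h r m : power_series_sum a h r ->
  exists b, power_series_sum b (fun y => (1 + y) ^+ m * h y) r.
Proof.
move=> ah; elim: m => [|m [b ih]].
  by exists a => y yr; rewrite expr0 mul1r; exact: ah.
eexists => y yr; rewrite exprS -mulrA.
exact: (power_series_mul1D ih).
Qed.

(** The exponent [m' - m] may be negative; clearing it turns both sides into power series in [y],
    whose difference has zeros accumulating at 0. *)
Lemma power_law_extension a h r c m m' : 0 < r -> power_series_sum a h r ->
  (forall e : R, 0 < e -> exists y : R, 0 < `|y| < e /\
     (1 + y) ^+ m * h y = c * (1 + y) ^+ m') ->
  forall y : R, `|y| < r -> (1 + y) ^+ m * h y = c * (1 + y) ^+ m'.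
Proof.
move=> r0 ah hz y yr.
have [b1 hb1] := power_series_mul1DX m ah.
have [b2 hb2] := power_series_mul1DX m' (@power_series_cst c r).
apply/eqP; rewrite -subr_eq0 [c * _]mulrC; apply/eqP.
apply: (power_series_accumulating_zeros_eq0 r0 (power_seriesB hb1 hb2) _ yr).
move=> e e0; have [z [ze hze]] := hz e e0.
by exists z; split => //; rewrite hze mulrC subrr.
Qed.

End power_series.

(** * Summing an absolutely convergent double series by columns *)

Section double_series.
Context {R : realType} (t : nat -> nat -> R).

Definition rectangle_abs_sum m p := \sum_(k < m) \sum_(l < p) `|t k l|.

Lemma rectangle_abs_sum_bounded :
  summable [set: nat * nat] (fun p => (t p.1 p.2)%:E) ->
  exists M, forall m p, rectangle_abs_sum m p <= M.
Proof.
rewrite /summable => tfin; set E := (\esum_(x in _) _)%E in tfin.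
exists (fine E) => m p.
have E0 : (0 <= E)%E by apply: esum_ge0.
rewrite -lee_fin fineK; last by rewrite ge0_fin_numE.
apply: esum_ge.
pose s := [seq (k, l) | k <- iota 0 m, l <- iota 0 p].
exists [set` s]; first by split; [exact: finite_seq|exact: subsetT].
rewrite -fsbig_seq; last first.
  by rewrite allpairs_uniq ?iota_uniq// => -[? ?] [? ?] _ _ /= [-> ->].
rewrite big_allpairs_dep/= /rectangle_abs_sum.
rewrite -(big_mkord xpredT (fun k => \sum_(l < p) `|t k l|)).
rewrite /index_iota subn0.
under [leRHS]eq_bigr do rewrite sumEFin.
rewrite sumEFin lee_fin le_eqVlt; apply/orP; left; apply/eqP.
apply: eq_bigr => k _.
by rewrite -(big_mkord xpredT (fun l => `|t k l|)) /index_iota subn0.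
Qed.

Lemma rectangle_abs_sum_le m m' p p' : (m <= m')%N -> (p <= p')%N ->
  rectangle_abs_sum m p <= rectangle_abs_sum m' p'.
Proof.
move=> mm pp; rewrite /rectangle_abs_sum.
apply: (@le_trans _ _ (\sum_(k < m) \sum_(l < p') `|t k l|)).
  apply: ler_sum => k _; rewrite -(subnKC pp) big_split_ord/= lerDl.
  by apply: sumr_ge0.
rewrite -(subnKC mm) big_split_ord/= lerDl.
by apply: sumr_ge0 => k _; apply: sumr_ge0.
Qed.

(** The extra terms of the rectangle lie in the square of side [p] outside the square of side
    [m]. *)
Lemma rectangle_sum_diff_le m p : (m <= p)%N ->
  `|\sum_(l < m) \sum_(k < p) t k l - \sum_(k < m) \sum_(l < m) t k l| <=
  rectangle_abs_sum p p - rectangle_abs_sum m m.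
Proof.
move=> mp; rewrite -(subnKC mp) {mp}; move: (p - m)%N => d.
rewrite [X in _ - X]exchange_big/= -sumrB.
have -> : \sum_(l < m) (\sum_(k < m + d) t k l - \sum_(k < m) t k l) =
    \sum_(l < m) \sum_(k < d) t (m + k)%N l.
  by apply: eq_bigr => l _; rewrite big_split_ord/= [LHS]addrC addKr.
apply: (@le_trans _ _ (\sum_(k < d) \sum_(l < m) `|t (m + k)%N l|)).
  rewrite exchange_big/= (le_trans (ler_norm_sum _ _ _))//.
  by apply: ler_sum => k _; exact: ler_norm_sum.
have md : (m <= m + d)%N by rewrite leq_addr.
rewrite lerBrDl (le_trans _ (rectangle_abs_sum_le (leqnn _) md))//.
by rewrite /rectangle_abs_sum big_split_ord.
Qed.

Lemma summable_double_series (v : R) :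
  summable [set: nat * nat] (fun p => (t p.1 p.2)%:E) ->
  (\sum_(k < m) \sum_(l < m) t k l) @[m --> \oo] --> v ->
  (forall l, cvgn (series (t^~ l))) /\
  series (fun l => limn (series (t^~ l))) @ \oo --> v.
Proof.
move=> /rectangle_abs_sum_bounded[M hM] tv.
have cl l : cvgn (series (t^~ l)).
  apply: normed_cvg; apply: nondecreasing_is_cvgn.
    apply/nondecreasing_seqP => n.
    rewrite -[leLHS]/(series (fun k => `|t k l|) n).
    rewrite -[leRHS]/(series (fun k => `|t k l|) n.+1) seriesSr lerDl.
    exact: normr_ge0.
  exists M => _ [n _ <-]; apply: le_trans (hM n l.+1).
  rewrite -[leLHS]/(series (fun k => `|t k l|) n) seriesEord; apply: ler_sum => k _.
  by rewrite big_ord_recr/= lerDr sumr_ge0.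
split => //.
pose Tm m := rectangle_abs_sum m m.
have ndT : nondecreasing_seq Tm by move=> m p mp; exact: rectangle_abs_sum_le.
have cT : cvgn Tm.
  by apply: nondecreasing_is_cvgn => //; exists M => _ [n _ <-]; exact: hM.
have sumcvg m : \sum_(l < m) series (t^~ l) p @[p --> \oo] -->
    \sum_(l < m) limn (series (t^~ l)).
  elim: m => [|m ih].
    rewrite big_ord0; under eq_cvg do rewrite big_ord0; exact: cvg_cst.
  rewrite big_ord_recr/=; under eq_cvg do rewrite big_ord_recr/=.
  by apply: cvgD => //; exact: cl.
have diff m : `|series (fun l => limn (series (t^~ l))) m -
    \sum_(k < m) \sum_(l < m) t k l| <= limn Tm - Tm m.
  have lim1 : `|\sum_(l < m) series (t^~ l) p - \sum_(k < m) \sum_(l < m) t k l|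
      @[p --> \oo] --> `|series (fun l => limn (series (t^~ l))) m -
    \sum_(k < m) \sum_(l < m) t k l|.
    apply: cvg_norm; apply: cvgB; last exact: cvg_cst.
    by have := sumcvg m; rewrite -(big_mkord xpredT (fun l => limn (series (t^~ l)))).
  rewrite -(cvg_lim (@norm_hausdorff _ R) lim1).
  apply: limr_le; first by apply/cvg_ex; eexists; exact: lim1.
  near=> p; have mp : (m <= p)%N by near: p; exact: nbhs_infty_ge.
  have := rectangle_sum_diff_le mp.
  under eq_bigr do rewrite -(big_mkord xpredT (fun k => t k _)).
  move=> /le_trans; apply; rewrite lerB//.
  exact: (nondecreasing_cvgn_le ndT cT p).
have lim0 : series (fun l => limn (series (t^~ l))) m -
    \sum_(k < m) \sum_(l < m) t k l @[m --> \oo] --> (0 : R).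
  apply/norm_cvg0P.
  apply: (@squeeze_cvgr _ _ _ _ (fun=> 0) (fun m => limn Tm - Tm m)).
  - by near=> m; rewrite normr_ge0 diff.
  - exact: cvg_cst.
  - by rewrite -(subrr (limn Tm)); apply: cvgB; [exact: cvg_cst|].
rewrite -[v]add0r.
rewrite (_ : series _ = fun m => (series (fun l => limn (series (t^~ l))) m -
    \sum_(k < m) \sum_(l < m) t k l) + \sum_(k < m) \sum_(l < m) t k l).
  exact: cvgD.
by apply/funext => m; rewrite subrK.
Unshelve. all: by end_near. Qed.

End double_series.

(** For fixed [x] the double series is regrouped by powers of [u]; uniqueness of coefficients
    identifies [al j] with the [j]-th column sum. *)
Lemma analytic_coefficient_power_series (R : realType) (f : R -> R -> R)
    (rho delta : R) (al : nat -> R -> R) : 0 < delta ->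
  analytic_on_box f 1 0 rho delta ->
  (forall x u : R, `|x - 1| < rho -> `|u| < delta ->
     series (fun j : nat => al j x * u ^+ j) @ \oo --> f x u) ->
  exists a : nat -> nat -> R, forall j,
    power_series_sum (a^~ j) (fun y => al j (1 + y)) rho.
Proof.
move=> d0 [a ha] hal; exists a => j y yr.
pose be l := limn (series (fun k => a k l * y ^+ k)).
have yE : 1 + y - 1 = y by rewrite addrC addKr.
have sE u l : series (fun k => a k l * y ^+ k * u ^+ l) =
    (fun n => series (fun k => a k l * y ^+ k) n * u ^+ l).
  by apply/funext => n; rewrite /series /= mulr_suml.
have hu (u : R) : `|u| < delta ->
    (forall l, cvgn (fun n => series (fun k => a k l * y ^+ k) n * u ^+ l)) /\
    series (fun l => limn (fun n => series (fun k => a k l * y ^+ k) n * u ^+ l))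
      @ \oo --> f (1 + y) u.
  move=> ud; have [] := ha (1 + y) u; rewrite ?yE ?subr0//.
  move=> su cu.
  have [c1 c2] := @summable_double_series R
    (fun k l => a k l * y ^+ k * u ^+ l) _ su cu.
  split=> [l|]; first by rewrite -sE; exact: c1.
  by under eq_fun do rewrite -sE.
(* Columns carry the factor [u ^+ l]; it is divided out at the nonzero point [u = delta / 2]. *)
have cl l : cvgn (series (fun k => a k l * y ^+ k)).
  have d2 : `|delta / 2| < delta by rewrite gtr0_norm ?divr_gt0//; lra.
  have [/(_ l) c1 _] := hu _ d2.
  have dl : (delta / 2) ^+ l != 0 by rewrite expf_neq0// gt_eqF// divr_gt0.
  have -> : series (fun k => a k l * y ^+ k) = (fun n =>
      series (fun k => a k l * y ^+ k) n * (delta / 2) ^+ l / (delta / 2) ^+ l).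
    by apply/funext => n; rewrite mulfK.
  by apply: is_cvgM => //; exact: is_cvg_cst.
have bef : power_series_sum be (f (1 + y)) delta.
  move=> u ud; have [_] := hu u ud.
  rewrite (_ : (fun l => limn _) = (fun l => be l * u ^+ l))//.
  apply/funext => l; rewrite limM//; last exact: is_cvg_cst.
  by rewrite lim_cst//; exact: norm_hausdorff.
have alf : power_series_sum (fun j => al j (1 + y)) (f (1 + y)) delta.
  by move=> u ud; apply: hal; rewrite ?yE.
by rewrite (power_series_unique d0 alf bef); exact: cl.
Qed.

(** * Comparison of the two expansions *)

Section polynomial_asymptotics.
Context {R : realType}.

(** Interpolation at the nodes [1, .., J + 1]: [C] is the sum of absolute values in the last column
    of the inverse Vandermonde matrix, hence depends on [J] only. *)
Lemma vandermonde_leading_coefficient_bound J : exists C : R, 0 <= C /\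
  forall (d : nat -> R) (E : R),
    (forall s : nat, (0 < s <= J.+1)%N ->
       `|\sum_(i < J.+1) d i * s%:R ^+ i| <= E) -> `|d J| <= C * E.
Proof.
pose a : 'rV[R]_J.+1 := \row_s (nat_of_ord s).+1%:R.
pose V := Vandermonde J.+1 a.
have Vu : V \in unitmx.
  rewrite unitmxE det_Vandermonde unitfE.
  apply/prodf_neq0 => i _; apply/prodf_neq0 => j ij.
  by rewrite !mxE subr_eq0 eqr_nat eqSS gtn_eqF.
exists (\sum_s `|(invmx V) s ord_max|); split; first exact: sumr_ge0.
move=> d E hE.
pose D : 'rV[R]_J.+1 := \row_i d i.
have -> : d J = D ord0 ord_max by rewrite mxE.
rewrite -[D](mulmxK Vu) mxE (le_trans (ler_norm_sum _ _ _))// mulr_suml.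
apply: ler_sum => s _; rewrite normrM mulrC ler_wpM2l// mxE.
rewrite (eq_bigr (fun i : 'I_J.+1 => d i * s.+1%:R ^+ i)); last first.
  by move=> i _; rewrite !mxE.
exact: (hE s.+1 (ltn_ord s)).
Qed.

(** Otherwise the leading term, of degree above [d], would exceed all the others together at a large
    integer. *)
Lemma poly_growth (A : {poly R}) (C : R) d m0 :
  (forall m, (m0 <= m)%N -> `|A.[m%:R]| <= C * m%:R ^+ d) ->
  forall i, (d < i)%N -> A`_i = 0.
Proof.
move=> hA i di.
have [sA|sA] := leqP (size A) d.+1.
  by rewrite nth_default// (leq_trans sA).
exfalso; pose s := (size A).-1.
have sE : size A = s.+1 by rewrite prednK// (leq_trans _ sA).
have ds : (d < s)%N by rewrite -ltnS -sE.
have l0 : 0 < `|A`_s|.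
  rewrite normr_gt0 -[A`_s]/(lead_coef A) lead_coef_eq0 -size_poly_eq0 sE//.
pose S := \sum_(i < s) `|A`_i|.
have S0 : 0 <= S by apply: sumr_ge0.
pose b : R := (`|C| + S) / `|A`_s|.
pose m := maxn m0 (Num.truncn b).+1.
have mm0 : (m0 <= m)%N by rewrite leq_maxl.
have m1 : (0 < m)%N by rewrite leq_max orbT.
have mr1 : 1 <= m%:R :> R by rewrite ler1n.
have big : `|C| + S < `|A`_s| * m%:R.
  rewrite mulrC -ltr_pdivrMr//; apply: lt_le_trans (truncnS_gt _) _.
  by rewrite ler_nat leq_maxr.
have mono a c : (a <= c)%N -> m%:R ^+ a <= m%:R ^+ c :> R.
  by move=> ac; rewrite ler_weXn2l.
have : `|A`_s| * m%:R ^+ s <= (`|C| + S) * m%:R ^+ s.-1.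
  have -> : `|A`_s| * m%:R ^+ s = `|A.[m%:R] - \sum_(i < s) A`_i * m%:R ^+ i|.
    by rewrite horner_coef sE big_ord_recr/= [X in _ = `|X|]addrC addKr normrM normrX normr_nat.
  rewrite (le_trans (ler_normB _ _))// mulrDl lerD//.
    rewrite (le_trans (hA m mm0))//.
    apply: (@le_trans _ _ (`|C| * m%:R ^+ d)).
      by rewrite ler_wpM2r ?exprn_ge0// ler_norm.
    by rewrite ler_wpM2l// mono// -ltnS prednK// (leq_ltn_trans _ ds).
  rewrite (le_trans (ler_norm_sum _ _ _))// mulr_suml; apply: ler_sum => j _.
  rewrite normrM normrX normr_nat ler_wpM2l// mono//.
  by have := ltn_ord j; lia.
have -> : m%:R ^+ s = m%:R * m%:R ^+ s.-1 :> R.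
  by rewrite -exprS prednK// (leq_ltn_trans _ ds).
rewrite mulrA ler_pM2r; last first.
  by rewrite exprn_gt0// ltr0n.
by rewrite leNgt big.
Qed.

(** Multiplying by [m ^ (L + 2G)] turns the difference of the two sides, up to the bounded
    contribution of [g > G], into the polynomial [A1 - A2] of growth [m ^ (L - 1)]. Its coefficient
    of [m ^ L] therefore vanishes, and this is the claim. *)
Lemma polynomial_asymptotic_coefficient (Q : {poly R}) (al : nat -> R)
    (a C : R) (p q L G K m0 : nat) :
  (0 < q)%N -> (0 < L)%N -> (G <= K)%N ->
  (forall m, (m0 <= m)%N -> (0 < m)%N ->
    `|a * Q.[(p * m)%:R] / m%:R ^+ L -
      \sum_(g < K.+1) al g / (q * m)%:R ^+ (2 * g)| * m%:R ^+ (2 * G).+1 <= C) ->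
  al G / q%:R ^+ (2 * G) =
  if (L < 2 * G)%N then 0 else a * Q`_(L - 2 * G) * p%:R ^+ (L - 2 * G).
Proof.
move=> q0 L0 GK h.
pose A1 : {poly R} := 'X^(2 * G) * \poly_(i < size Q) (a * Q`_i * p%:R ^+ i).
pose A2 : {poly R} := \sum_(g < G.+1) (al g / q%:R ^+ (2 * g)) *: 'X^(L + 2 * (G - g)).
pose C' := \sum_(g < K.+1) `|al g|.
have C'0 : 0 <= C' by apply: sumr_ge0.
have qr : 0 < q%:R :> R by rewrite ltr0n.
have q1 : 1 <= q%:R :> R by rewrite ler1n.
have bound m : (maxn m0 1 <= m)%N -> `|(A1 - A2).[m%:R]| <= (C + C') * m%:R ^+ L.-1.
  rewrite geq_max => /andP[mm0 m1].
  have mr : 0 < m%:R :> R by rewrite ltr0n.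
  have mne : m%:R != 0 :> R by rewrite gt_eqF.
  have mr1 : 1 <= m%:R :> R by rewrite ler1n.
  have A1E : A1.[m%:R] = m%:R ^+ (L + 2 * G) * (a * Q.[(p * m)%:R] / m%:R ^+ L).
    rewrite /A1 hornerM hornerXn horner_poly.
    have -> : \sum_(i < size Q) a * Q`_i * p%:R ^+ i * m%:R ^+ i = a * Q.[(p * m)%:R].
      rewrite horner_coef mulr_sumr; apply: eq_bigr => i _.
      by rewrite natrM exprMn !mulrA.
    rewrite exprD; have : m%:R ^+ L != 0 :> R by rewrite expf_neq0.
    by move=> ?; field.
  have A2E : A2.[m%:R] = m%:R ^+ (L + 2 * G) *
      \sum_(g < G.+1) al g / (q * m)%:R ^+ (2 * g).
    rewrite /A2 horner_sum mulr_sumr; apply: eq_bigr => g _.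
    rewrite hornerZ hornerXn.
    have -> : (L + 2 * G = L + 2 * (G - g) + 2 * g)%N by have := ltn_ord g; lia.
    rewrite [m%:R ^+ (_ + 2 * g)]exprD natrM exprMn.
    have ? : m%:R ^+ (2 * g) != 0 :> R by rewrite expf_neq0.
    have ? : q%:R ^+ (2 * g) != 0 :> R by rewrite expf_neq0// gt_eqF.
    by field; apply/andP.
  set X := a * Q.[(p * m)%:R] / m%:R ^+ L in A1E.
  have := h m mm0 m1; rewrite -/X.
  have -> : K = (G + (K - G))%N by rewrite subnKC.
  rewrite -addSn big_split_ord/=.
  set S1 := \sum_(g < G.+1) _; set S2 := \sum_(g < K - G) _ => hm.
  have S2b : `|S2| * m%:R ^+ (2 * G).+1 <= C'.
    rewrite /S2 (le_trans (ler_wpM2r _ (ler_norm_sum _ _ _))) ?exprn_ge0//.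
    apply: (@le_trans _ _ (\sum_(g < K - G) `|al (G.+1 + g)%N|)); last first.
      rewrite /C' (_ : K.+1 = (G.+1 + (K - G))%N); last by lia.
      by rewrite big_split_ord/= lerDr sumr_ge0.
    rewrite mulr_suml; apply: ler_sum => g _.
    rewrite normrM -mulrA ler_piMr// normfV normrX normr_nat.
    rewrite mulrC ler_pdivrMr ?exprn_gt0 ?ltr0n ?muln_gt0 ?q0// mul1r.
    rewrite natrM (@le_trans _ _ (m%:R ^+ (2 * (G.+1 + g))))//.
      by rewrite ler_weXn2l//; lia.
    by rewrite lerXn2r ?nnegrE ?mulr_ge0// ler_peMl.
  rewrite hornerD hornerN A1E A2E -/S1 -mulrBr normrM (ger0_norm (exprn_ge0 _ (ltW mr))).
  have -> : (L + 2 * G = L.-1 + (2 * G).+1)%N by lia.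
  rewrite exprD -mulrA mulrC ler_wpM2r ?exprn_ge0//.
  rewrite (_ : X - S1 = (X - (S1 + S2)) + S2); last by ring.
  rewrite mulrC (le_trans (ler_wpM2r _ (ler_normD _ _))) ?exprn_ge0//.
  by rewrite mulrDl lerD.
have := poly_growth bound (i := L); rewrite prednK// => /(_ (leqnn _)).
rewrite coefB /A1 coefXnM coef_poly /A2 coef_sum big_ord_recr/= big1 => [|g _].
  rewrite coefZ coefXn subnn muln0 addn0 eqxx mulr1 add0r => /eqP.
  rewrite subr_eq0 => /eqP <-; case: ifP => // LG.
  by case: ltnP => // sQ; rewrite nth_default// mulr0 mul0r.
rewrite coefZ coefXn (_ : _ == _ = false) ?mulr0//.
by apply/negP => /eqP; have := ltn_ord g; lia.
Qed.

End polynomial_asymptotics.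

(** * Identification of the coefficients at the points [1 + 1 / k] *)

Section expansion_coefficients.
Context {R : realType} (nu : nat).
Hypothesis nu_gt0 : (0 < nu)%N.

(** Since [N >= 1] gives [t <= u], both the smallness condition and the remainder can be stated in
    [u], with constants free of [N]. *)
Lemma free_energy_expansion J : exists (P : nat -> {poly R}) C B, 1 <= C /\
  forall n N (u : R), (0 < n)%N -> (0 < N)%N -> 0 <= u -> C * n%:R ^+ B * u <= 1 ->
  `|free_energy nu n N u -
    \sum_(j < J.+1) (P j).[n%:R] / (n%:R ^+ 2 * N%:R ^+ (nu.-1 * j)) * u ^+ j|
  <= C * n%:R ^+ B * u ^+ J.+1.
Proof.
have [m [m0 hm]] := @laplace_expansion R nu nu_gt0.
have [P [C [B [C1 h]]]] := log_expansion m0 J.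
exists P, C, B; split => // n N u n0 N0 u0 Cu.
pose t := u / N%:R ^+ nu.-1.
have n1 : 1 <= n%:R :> R by rewrite ler1n.
have N1 : 1 <= N%:R ^+ nu.-1 :> R by rewrite exprn_ege1// ler1n.
have N0r : 0 < N%:R ^+ nu.-1 :> R by rewrite (lt_le_trans ltr01).
have t0 : 0 <= t by rewrite divr_ge0// ltW.
have tu : t <= u by rewrite ler_pdivrMr// ler_peMr.
have D0 : 0 <= C * n%:R ^+ B by rewrite mulr_ge0 ?exprn_ge0// (le_trans ler01).
have Ct : C * n%:R ^+ B * t <= 1 by rewrite (le_trans _ Cu)// ler_wpM2l.
have := h n t _ n0 t0 Ct (hm J.+1 n N u t N0 u0 erefl).
set X := _ / _ => hX.
rewrite /free_energy -/X.
rewrite (_ : _ - _ = (n%:R ^+ 2)^-1 * (ln X - \sum_(j < J.+1) (P j).[n%:R] * t ^+ j)).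
  rewrite normrM ger0_norm ?invr_ge0 ?exprn_ge0//.
  apply: (@le_trans _ _ (C * n%:R ^+ B * t ^+ J.+1)).
    rewrite (le_trans _ hX)// ler_piMl// invf_le1 ?exprn_ege1//.
    by rewrite exprn_gt0// (lt_le_trans ltr01).
  by rewrite ler_wpM2l// lerXn2r ?nnegrE.
rewrite mulrBr mulr_sumr; congr (_ - _); apply: eq_bigr => j _.
by rewrite /t expr_div_n -exprM invfM; ring.
Qed.

(** Finitely many tails are added; as [N^(-2g) <= 1], the bound is uniform in [N]. *)
Lemma power_series_family_tail (f : nat -> R -> R) (al : nat -> nat -> R)
    (delta : nat -> R) K J : (forall g, 0 < delta g) ->
  (forall g, (g < K)%N -> power_series_sum (al g) (f g) (delta g)) ->
  exists C r, [/\ 0 <= C, 0 < r & forall (u : R) N, 0 <= u <= r -> (0 < N)%N ->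
    `|\sum_(g < K) f g u / N%:R ^+ (2 * g) -
      \sum_(g < K) (\sum_(i < J) al g i * u ^+ i) / N%:R ^+ (2 * g)| <= C * u ^+ J].
Proof.
move=> d0; elim: K => [|K ih] hf.
  exists 0, 1; split => // u N _ _.
  by rewrite !big_ord0 subr0 normr0 mul0r.
have [C [r [C0 r0 h]]] := ih (fun g gK => hf g (ltnW gK)).
have [C2 [r2 [C20 r20 h2]]] := power_series_tail J (d0 K) (hf K (ltnSn K)).
exists (C + C2), (Num.min r r2); split.
- exact: addr_ge0.
- by rewrite lt_min r0.
move=> u N /andP[u0]; rewrite le_min => /andP[ur ur2] N0.
rewrite !big_ord_recr/= opprD addrACA (le_trans (ler_normD _ _))// mulrDl lerD//.
  by apply: h; rewrite ?u0.
have := h2 u; rewrite ger0_norm// => /(_ ur2) hu.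
rewrite -mulrBl normrM (le_trans _ hu)// ler_piMr// normfV ger0_norm ?exprn_ge0//.
by rewrite invf_le1 ?exprn_gt0 ?ltr0n// exprn_ege1// ler1n.
Qed.

Context (f : nat -> R -> R -> R) (rho delta : nat -> R)
  (rho_gt0 : forall g, 0 < rho g) (delta_gt0 : forall g, 0 < delta g)
  (hexpansion : topological_expansion nu f) (alpha : nat -> nat -> R -> R).
Hypothesis halpha : forall (g : nat) (x u : R),
  `|x - 1| < rho g -> `|u| < delta g ->
  series (fun j : nat => alpha g j x * u ^+ j) @ \oo --> f g x u.

(* With [n = (k + 1) m], [N = k m] and [u = s m ^- M] for [s = 1, .., J + 1],
   Vandermonde inversion isolates the coefficient of [u ^+ J] in both
   expansions; [M] is chosen larger than the degree in [n] of the remainder of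
   the first expansion and then [K] so large that [N ^- (2 K.+1)] is negligible
   compared with [u ^+ J * N ^- (2 G)]. *)
Lemma coefficient_near_1 G J : exists c e : R, [/\ 0 < e,
  (nu.-1 * J + 2 < 2 * G)%N -> c = 0 &
  forall k, (0 < k)%N -> k%:R^-1 < e ->
    (1 + k%:R^-1) ^+ (2 * G) * alpha G J (1 + k%:R^-1) =
    c * (1 + k%:R^-1) ^+ (nu.-1 * J)].
Proof.
have [P [C [B [C1 hF]]]] := free_energy_expansion J.
have [Cv [Cv0 hV]] := @vandermonde_leading_coefficient_bound R J.
(* [m^B u^(J+1)] is then of order [m^(-2G-1) u^J], while [2 (K + 1) >= M J + 2G + 1] makes the
   topological remainder at most of that order. *)
pose M := (B + (2 * G).+1)%N; pose K := (M * J + G)%N.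
have MJK : (M * J + (2 * G).+1 <= 2 * K.+1)%N.
  by rewrite /K; move: (M * J)%N => t; lia.
have [eps [del [C' [N0 [eps0 del0 hE]]]]] := hexpansion K.
(* Only indices [g <= K] occur, so a common radius exists even if the [rho g] tend to 0. *)
have [r r0 hr] : exists2 r : R, 0 < r & forall g, (g < K.+1)%N -> r <= rho g.
  elim: K.+1 => [|K' [r r0 ih]]; first by exists 1.
  exists (Num.min r (rho K')); first by rewrite lt_min r0 rho_gt0.
  move=> g; rewrite ltnS leq_eqVlt => /orP[/eqP ->|/ih gr].
    by rewrite ge_min lexx orbT.
  by rewrite ge_min gr.
pose L := (nu.-1 * J + 2)%N.
(* [L - 2G] is [D + 2]; the case distinction is needed because subtraction of naturals would
   truncate a negative value to 0. *)
exists (if (L < 2 * G)%N then 0 else (P J)`_(L - 2 * G)), (Num.min eps r).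
split; [by rewrite lt_min eps0|by rewrite /L => ->|].
move=> k k0; rewrite lt_min => /andP[keps kr].
have kR : 0 < k%:R :> R by rewrite ltr0n.
set x := 1 + k%:R^-1.
have x1 : `|x - 1| = k%:R^-1.
  by rewrite /x addrC addKr ger0_norm// invr_ge0 ltW.
have xE : x = k.+1%:R / k%:R by rewrite /x -natr1 mulrDl mul1r divff ?gt_eqF.
have hps g : (g < K.+1)%N -> power_series_sum (fun i => alpha g i x) (f g x) (delta g).
  move=> gK u ud; apply: halpha => //.
  by rewrite x1 (lt_le_trans kr)// hr.
have [Ct [rt [Ct0 rt0 hT]]] := power_series_family_tail J.+1 delta_gt0 hps.
pose S : R := J.+1%:R.
have S0 : 0 < S by rewrite ltr0n.
have C0 : 0 <= C by rewrite (le_trans ler01).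
(* For [m >= b] all three smallness conditions on [u] hold: [u < del], [u <= rt] and
   [C n^B u <= 1]. *)
pose b := S / del + S / rt + C * k.+1%:R ^+ B * S.
pose m0 := maxn N0 (Num.truncn b).+1.
pose A1 := (C * k.+1%:R ^+ B + Ct) * S ^+ J.+1.
pose A2 := `|C'|.
(* Difference of the coefficients of [u ^+ i] in the two expansions, at [n = (k + 1) m] and
   [N = k m]. *)
pose d m i := (P i).[(k.+1 * m)%:R] /
    ((k.+1 * m)%:R ^+ 2 * (k * m)%:R ^+ (nu.-1 * i)) -
  \sum_(g < K.+1) alpha g i x / (k * m)%:R ^+ (2 * g).
have A10 : 0 <= A1.
  by rewrite mulr_ge0 ?exprn_ge0 ?addr_ge0 ?mulr_ge0 ?exprn_ge0// ltW.
have main m : (m0 <= m)%N -> (0 < m)%N ->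
    `|d m J| * m%:R ^+ (2 * G).+1 <= Cv * (A1 + A2).
  rewrite geq_max => /andP[N0m bm] m1.
  have mR : 0 < m%:R :> R by rewrite ltr0n.
  have mne : m%:R != 0 :> R by rewrite gt_eqF.
  have mR1 : 1 <= m%:R :> R by rewrite ler1n.
  have bm' : b <= m%:R.
    by rewrite (le_trans (ltW (truncnS_gt b)))// ler_nat.
  have b1 : 0 < S / del by rewrite divr_gt0.
  have b2 : 0 < S / rt by rewrite divr_gt0.
  have b3 : 0 <= C * k.+1%:R ^+ B * S by rewrite !mulr_ge0 ?exprn_ge0// ltW.
  have Mm a : 0 < m%:R ^+ a :> R by rewrite exprn_gt0.
  (* The first term collects the two remainders of order [u ^+ J.+1], the second is the topological
     remainder. *)
  pose E := A1 * m%:R ^+ B / m%:R ^+ (M * J.+1) + A2 / m%:R ^+ (2 * K.+1).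
  have key (s : nat) : (0 < s <= J.+1)%N ->
      `|\sum_(i < J.+1) (d m i / m%:R ^+ (M * i)) * s%:R ^+ i| <= E.
    move=> /andP[s0 sJ].
    pose u : R := s%:R / m%:R ^+ M.
    have u0 : 0 < u by rewrite divr_gt0// ltr0n.
    have sS : s%:R <= S by rewrite ler_nat.
    have uS : u <= S / m%:R.
      rewrite /u; apply: ler_pM; rewrite ?invr_ge0//.
      rewrite lef_pV2 ?posrE// /M addnS exprS ler_peMr ?exprn_ege1// ltW//.
    have udel : u < del.
      rewrite (le_lt_trans uS)// ltr_pdivrMr// mulrC -ltr_pdivrMr//.
      by rewrite (lt_le_trans _ bm')// /b; lra.
    have urt : u <= rt.
      rewrite (le_trans uS)// ler_pdivrMr// mulrC -ler_pdivrMr//.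
      by rewrite (le_trans _ bm')// /b; lra.
    have CnB : C * (k.+1 * m)%:R ^+ B = C * k.+1%:R ^+ B * m%:R ^+ B.
      by rewrite natrM exprMn mulrA.
    have uB : m%:R ^+ B * u <= S / m%:R.
      have -> : m%:R ^+ B * u = s%:R / m%:R ^+ (2 * G).+1.
        rewrite /u /M exprD; have ? := lt0r_neq0 (Mm B).
        have ? := lt0r_neq0 (Mm (2 * G).+1).
        by field; apply/andP.
      apply: ler_pM; rewrite ?invr_ge0 ?ler0n ?(ltW (Mm _))//.
      by rewrite lef_pV2 ?posrE// exprS ler_peMr ?exprn_ege1// ltW.
    have Cu : C * (k.+1 * m)%:R ^+ B * u <= 1.
      rewrite CnB -mulrA (le_trans (ler_wpM2l _ uB)) ?mulr_ge0 ?exprn_ge0//.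
      rewrite mulrA ler_pdivrMr// mul1r (le_trans _ bm')// /b; lra.
    have nx : (k.+1 * m)%:R / (k * m)%:R = x.
      by rewrite !natrM xE -mulf_div divff// mulr1.
    have n0 : (0 < k.+1 * m)%N by rewrite muln_gt0.
    have N0' : (0 < k * m)%N by rewrite muln_gt0 k0.
    have h1 := hF (k.+1 * m)%N (k * m)%N u n0 N0' (ltW u0) Cu.
    have h2 : `|free_energy nu (k.+1 * m) (k * m) u -
        \sum_(g < K.+1) f g x u / (k * m)%:R ^+ (2 * g)| <= A2 / m%:R ^+ (2 * K.+1).
      have := hE (k.+1 * m)%N (k * m)%N u; rewrite nx x1 => h2.
      apply: le_trans (h2 _ _ _ _ _) _ => //.
      - by rewrite (leq_trans N0m)// leq_pmull.
      - by rewrite u0.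
      apply: (@le_trans _ _ (A2 / (k * m)%:R ^+ (2 * K.+1))).
        by rewrite ler_wpM2r ?invr_ge0 ?exprn_ge0// ler_norm.
      rewrite ler_wpM2l ?normr_ge0// lef_pV2 ?posrE ?exprn_gt0 ?ltr0n ?muln_gt0 ?k0//.
      by rewrite lerXn2r ?nnegrE// ler_nat leq_pmull.
    have urt' : 0 <= u <= rt by rewrite (ltW u0).
    have h3 := hT u (k * m)%N urt' N0'.
    have -> : \sum_(i < J.+1) d m i / m%:R ^+ (M * i) * s%:R ^+ i =
        \sum_(i < J.+1) (P i).[(k.+1 * m)%:R] /
          ((k.+1 * m)%:R ^+ 2 * (k * m)%:R ^+ (nu.-1 * i)) * u ^+ i -
        \sum_(g < K.+1) (\sum_(i < J.+1) alpha g i x * u ^+ i) / (k * m)%:R ^+ (2 * g).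
      under [X in _ = _ - X]eq_bigr do rewrite mulr_suml.
      rewrite exchange_big/= -sumrB; apply: eq_bigr => i _.
      rewrite /d /u expr_div_n -exprM mulrAC -mulrA mulrBl; congr (_ - _).
      by rewrite mulr_suml; apply: eq_bigr => g _; rewrite mulrAC.
    move: h1 h2 h3.
    set F := free_energy _ _ _ _; set SP := \sum_(i < J.+1) _.
    set Sf := \sum_(g < K.+1) f g x u / _; set Sa := \sum_(g < K.+1) _ / _ => h1 h2 h3.
    rewrite (_ : SP - Sa = (F - Sf) + (Sf - Sa) - (F - SP)); last by ring.
    apply: (le_trans (ler_normB _ _)).
    apply: (le_trans (lerD (le_trans (ler_normD _ _) (lerD h2 h3)) h1)).
    have uJ : u ^+ J.+1 <= S ^+ J.+1 / m%:R ^+ (M * J.+1).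
      by rewrite /u expr_div_n -exprM ler_wpM2r ?invr_ge0 ?(ltW (Mm _))// lerXn2r ?nnegrE// ltW.
    have mB1 : 1 <= m%:R ^+ B :> R by rewrite exprn_ege1.
    rewrite CnB /E /A1.
    move: uJ; set U := u ^+ J.+1; set W := (m%:R ^+ (M * J.+1))^-1 => uJ.
    have U0 : 0 <= U by rewrite exprn_ge0// ltW.
    have D0 : 0 <= C * k.+1%:R ^+ B by rewrite mulr_ge0 ?exprn_ge0.
    have e1 : C * k.+1%:R ^+ B * m%:R ^+ B * U <=
        C * k.+1%:R ^+ B * m%:R ^+ B * (S ^+ J.+1 * W).
      by rewrite ler_wpM2l// mulr_ge0// ltW.
    have e2 : Ct * U <= Ct * m%:R ^+ B * (S ^+ J.+1 * W).
      apply: ler_pM => //.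
      by rewrite ler_peMr.
    have -> : (C * k.+1%:R ^+ B + Ct) * S ^+ J.+1 * m%:R ^+ B * W =
        C * k.+1%:R ^+ B * m%:R ^+ B * (S ^+ J.+1 * W) +
        Ct * m%:R ^+ B * (S ^+ J.+1 * W) by ring.
    by lra.
  (* At [u = s m^(-M)] the difference of the two truncated sums is a polynomial in [s], so its top
     coefficient is controlled by its values at the nodes. *)
  have := hV (fun i => d m i / m%:R ^+ (M * i)) E key.
  rewrite normrM normfV (gtr0_norm (Mm _)) ler_pdivrMr// => hd.
  apply: (le_trans (ler_wpM2r (ltW (Mm _)) hd)).
  rewrite -!mulrA ler_wpM2l// -exprD mulrDl lerD//.
    have -> : m%:R ^+ (M * J.+1) = m%:R ^+ B * m%:R ^+ (M * J + (2 * G).+1) :> R.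
      by rewrite -exprD mulnS {1}/M -addnA [((2 * G).+1 + _)%N]addnC.
    by rewrite invfM mulrA mulfK ?gt_eqF// divfK ?gt_eqF.
  rewrite mulrAC ler_pdivrMr// ler_wpM2l ?normr_ge0//.
  by rewrite ler_weXn2l.
have L0 : (0 < L)%N by rewrite /L addn2.
have GK : (G <= K)%N by rewrite leq_addl.
have k1ne : k.+1%:R != 0 :> R by rewrite pnatr_eq0.
have hm m : (m0 <= m)%N -> (0 < m)%N ->
    `|(k.+1%:R ^+ 2 * k%:R ^+ (nu.-1 * J))^-1 * (P J).[(k.+1 * m)%:R] / m%:R ^+ L -
      \sum_(g < K.+1) alpha g J x / (k * m)%:R ^+ (2 * g)| * m%:R ^+ (2 * G).+1
    <= Cv * (A1 + A2).
  move=> mm0 m1; rewrite (le_trans _ (main m mm0 m1))// le_eqVlt; apply/orP; left.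
  apply/eqP; congr (`|_ - _| * _); rewrite /L exprD !natrM !exprMn.
  by rewrite !invfM; ring.
have /= e := @polynomial_asymptotic_coefficient R (P J) (fun g => alpha g J x)
  _ _ _ _ _ _ _ _ k0 L0 GK hm.
have -> : x ^+ (2 * G) * alpha G J x =
    k.+1%:R ^+ (2 * G) * (alpha G J x / k%:R ^+ (2 * G)).
  by rewrite xE expr_div_n; ring.
rewrite e; case: ltnP => LG; first by rewrite mulr0 mul0r.
rewrite xE expr_div_n.
have LE : k.+1%:R ^+ (L - 2 * G) * k.+1%:R ^+ (2 * G) =
    k.+1%:R ^+ (nu.-1 * J) * k.+1%:R ^+ 2 :> R.
  by rewrite -!exprD subnK.
rewrite [LHS](_ : _ = k.+1%:R ^+ (L - 2 * G) * k.+1%:R ^+ (2 * G) /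
  (k.+1%:R ^+ 2 * k%:R ^+ (nu.-1 * J)) * (P J)`_(L - 2 * G)); last by ring.
by rewrite LE invfM mulrA mulfK ?expf_neq0// mulrC.
Qed.

End expansion_coefficients.

Theorem theorem2p2 (R : realType) (nu : nat) (hnu : (1 <= nu)%N)
    (f : nat -> R -> R -> R) (rho delta : nat -> R)
    (hrho : forall g, 0 < rho g) (hdelta : forall g, 0 < delta g)
    (hanalytic : forall g, analytic_on_box (f g) 1 0 (rho g) (delta g))
    (hexpansion : topological_expansion nu f)
    (alpha : nat -> nat -> R -> R)
    (halpha : forall (g : nat) (x u : R),
        `|x - 1| < rho g -> `|u| < delta g ->
        series (fun j : nat => alpha g j x * u ^+ j) @ \oo --> f g x u) :
  exists c : nat -> nat -> R, forall g j : nat,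
    (forall x : R, 0 < x -> `|x - 1| < rho g ->
       alpha g j x = c g j * x ^ scaling_exponent nu g j) /\
    (scaling_exponent nu g j < - 2 ->
       c g j = 0 /\
       forall x : R, 0 < x -> `|x - 1| < rho g -> alpha g j x = 0).
Proof.
have sE g j : scaling_exponent nu g j = (nu.-1 * j)%:Z - (2 * g)%:Z.
  rewrite /scaling_exponent !PoszM mulrC; congr (_ * _ - _).
  by rewrite -{1}(prednK hnu); lia.
have power_law g j : exists c : R,
    ((nu.-1 * j + 2 < 2 * g)%N -> c = 0) /\
    forall x : R, 0 < x -> `|x - 1| < rho g ->
      alpha g j x = c * x ^ scaling_exponent nu g j.
  have [a ha] := analytic_coefficient_power_series (hdelta g) (hanalytic g) (halpha g).
  have [c [e [e0 c0 hc]]] :=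
    coefficient_near_1 hnu hrho hdelta hexpansion halpha g j.
  exists c; split=> // x x0 xr.
  (* The law is first extended with the negative power cleared; dividing by [x ^+ (2 * g)] then uses
     [0 < x]. *)
  have E : x ^+ (2 * g) * alpha g j x = c * x ^+ (nu.-1 * j).
    rewrite -[in LHS](subrK 1 x) -[in RHS](subrK 1 x) ![_ - 1 + 1]addrC.
    apply: (power_law_extension (hrho g) (ha j) _ xr) => r r0.
    pose b := Num.max e^-1 r^-1; pose k := (Num.truncn b).+1.
    have kb : b < k%:R by exact: truncnS_gt.
    have kR : 0 < k%:R :> R by rewrite ltr0n.
    exists k%:R^-1; rewrite ger0_norm ?invr_ge0 ?ler0n// invr_gt0 kR/=.
    move: kb; rewrite gt_max => /andP[ek rk]; split.
      by rewrite invf_plt ?posrE.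
    by apply: hc => //; rewrite invf_plt ?posrE.
  have xg : x ^+ (2 * g) != 0 by rewrite expf_neq0// gt_eqF.
  apply: (mulfI xg); rewrite E mulrCA; congr (_ * _).
  rewrite !exprnP -expfzDr ?gt_eqF//; congr (_ ^ _).
  by rewrite sE; lia.
have [c hc] := choice (fun gj : nat * nat => power_law gj.1 gj.2).
exists (fun g j => c (g, j)) => g j; have [/= c0 ax] := hc (g, j).
split=> // D2; have cz : c (g, j) = 0 by apply: c0; move: D2; rewrite sE; lia.
by split=> // x x0 xr; rewrite ax// cz mul0r.
Qed.
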